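(* There is an algorithm that, given a tournament, enumerates all of its minimal feedback vertex sets with polynomial delay and uses polynomial space.
   Context: A tournament $T=(V,A)$ is a directed graph with exactly one arc between every pair of distinct vertices. A feedback vertex set is a set $F\subseteq V$ with $T[V\setminus F]$ acyclic; it is minimal if no proper subset is a feedback vertex set. Enumeration with polynomial delay means each output (each minimal feedback vertex set, each exactly once) is produced within time polynomial in $|V|$ after the previous one (or after the start), and the algorithm terminates within polynomial time after the last output. *)

(* Defs.v *)
From mathcomp Require Import all_boot all_order all_algebra.

Set Implicit Arguments.
Unset Strict Implicit.
Unset Printing Implicit Defensive.

Section Tournaments.

Variables (V : finType) (arc : rel V).

Definition tournament : Prop :=
  irreflexive arc /\ forall x y : V, x != y -> arc x y (+) arc y x.

(* The subdigraph induced by A has no directed cycle; [::] is the one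
   degenerate sequence that [ucycle] accepts as a cycle. *)
Definition acyclic_on (A : {set V}) : Prop :=
  forall c : seq V, {subset c <= A} -> ucycle arc c -> c = [::].

Definition fvs (F : {set V}) : Prop := acyclic_on (~: F).

Definition minimal_fvs (F : {set V}) : Prop :=
  fvs F /\ forall G : {set V}, G \proper F -> ~ fvs G.

End Tournaments.

(* Model of computation: random access machines, programmed by while programs.
   The memory consists of arrays of natural numbers, named by naturals; a
   program names only finitely many of them, and a scalar variable is cell 0 of
   an array.  Unwritten cells read as 0.

   Every command costs one unit of time.  The only arithmetic operations are
   addition and truncated subtraction, and a program contains finitely many
   expressions, so that one step lengthens the stored numbers by O(1) bits:
   this unit-cost model is polynomially equivalent to Turing machines. *)

Inductive expr : Type :=
| Const of nat
| Read of nat & expr              (* array, index *)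
| Plus of expr & expr
| Minus of expr & expr.

Inductive cmd : Type :=
| Skip
| Write of nat & expr & expr      (* array, index, value *)
| Seq of cmd & cmd
| If of expr & cmd & cmd
| While of expr & cmd
| Print of expr                   (* print one number *)
| Emit.                           (* end the solution being printed *)

Definition memory := seq (seq nat).

Definition read (m : memory) (a i : nat) : nat := nth 0 (nth [::] m a) i.

Definition write (m : memory) (a i v : nat) : memory :=
  set_nth [::] m a (set_nth 0 (nth [::] m a) i v).

Fixpoint eval (m : memory) (e : expr) : nat :=
  match e with
  | Const k => k
  | Read a e1 => read m a (eval m e1)
  | Plus e1 e2 => eval m e1 + eval m e2
  | Minus e1 e2 => eval m e1 - eval m e2
  end.

(* [code] is the stack of commands still to be executed, the control state of
   the machine: it ranges over a finite set determined by the program.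
   [printed] is the part of the write-only output since the last [Emit]; a
   program cannot read it back. *)
Record config := Config { code : seq cmd; store : memory; printed : seq nat }.

Definition step (s : config) : config :=
  let: Config k m o := s in
  match k with
  | [::] => s
  | Skip :: k' => Config k' m o
  | Write a e1 e2 :: k' => Config k' (write m a (eval m e1) (eval m e2)) o
  | Seq c1 c2 :: k' => Config (c1 :: c2 :: k') m o
  | If e c1 c2 :: k' => Config ((if eval m e != 0 then c1 else c2) :: k') m o
  | While e c :: k' => Config (if eval m e != 0 then c :: k else k') m o
  | Print e :: k' => Config k' m (rcons o (eval m e))
  | Emit :: k' => Config k' m [::]
  end.

Definition run (P : cmd) (input : seq nat) (t : nat) : config :=
  iter t step (Config [:: P] [:: input] [::]).

Definition emitted (s : config) : option (seq nat) :=
  if code s is Emit :: _ then Some (printed s) else None.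

(* The solutions output during the first t steps, in order, each one paired
   with its output time, i.e. the number of steps after which it is complete. *)
Definition outputs (P : cmd) (input : seq nat) (t : nat) :
    seq (nat * seq nat) :=
  pmap (fun i => omap (pair i.+1) (emitted (run P input i))) (iota 0 t).

(* Total bit length of the memory cells up to the last one written in each
   array. *)
Definition space_used (s : config) : nat :=
  \sum_(a <- store s) \sum_(v <- a) (trunc_log 2 v).+1.

(* The number n of vertices, then the n x n adjacency matrix row by row. *)
Definition encode (n : nat) (arc : rel 'I_n) : seq nat :=
  n :: [seq nat_of_bool (arc x y) | x <- enum 'I_n, y <- enum 'I_n].

(* A set is printed as the list of its elements, in any order, without
   repetition. *)
Definition represents (n : nat) (s : seq nat) (F : {set 'I_n}) : bool :=
  perm_eq s [seq val x | x <- enum F].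

(* Started on [input], P outputs each set satisfying S exactly once and nothing
   else, and then halts; the first output occurs within d steps after the start,
   each later one within d steps after the previous one, and P halts within d
   steps after the last one (after the start, if there is none). *)
Definition enumerates_with_delay (P : cmd) (input : seq nat)
    (n : nat) (S : {set 'I_n} -> Prop) (d : nat) : Prop :=
  exists (halt : nat) (Fs : seq {set 'I_n}),
    let out := outputs P input halt in
    [/\ code (run P input halt) = [::] /\ printed (run P input halt) = [::],
        uniq Fs /\ (forall F : {set 'I_n}, F \in Fs <-> S F),
        all2 (@represents n) (unzip2 out) Fs
      & path (fun t t' => t <= t' <= t + d) 0 (rcons (unzip1 out) halt)].

(* Main.v *)
Require Import Defs.
From mathcomp Require Import all_boot all_order all_algebra.
From mathcomp Require Import zify.

(** Call a vertex set transitive if it contains no directed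
    triangle; the minimal feedback vertex sets are the complements of the
    maximal transitive sets.  As in the algorithm of Tsukiyama, Ide, Ariyoshi
    and Shirakawa for maximal independent sets, arrange the maximal transitive
    subsets of [{0, .., k-1}], for [k <= n], in a tree: the parent of a
    maximal transitive subset [Y] of [{0, .., k}] is the greedy completion of
    [Y] minus [k] within [{0, .., k-1}].  The children of [X] are [X] itself
    (if maximal) and some sets made of [k] and the part of [X] compatible with
    an insertion of [k] at one place of the linear order of [X].  Hence there
    are at most [k+2] candidates, each testable in polynomial time, and every
    node has a child, so that a depth-first search never dies out before the
    leaves (at level [n]): polynomial delay.  It stores one set and one counter
    per level: polynomial space. *)

Set Implicit Arguments.
Unset Strict Implicit.
Unset Printing Implicit Defensive.

(** * Maximal transitive sets of a tournament *)

Lemma nth_allpairs (S T R : Type) (f : S -> T -> R) s t x0 y0 z0 i j :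
  i < size s -> j < size t ->
  nth z0 [seq f x y | x <- s, y <- t] (i * size t + j) =
    f (nth x0 s i) (nth y0 t j).
Proof.
elim: s i => // x s IHs [|i] /= si tj; rewrite nth_cat size_map ?add0n.
  by rewrite tj (nth_map y0).
by rewrite mulSn -addnA ltnNge leq_addr /= addKn IHs.
Qed.

Section Transitive.

Variables (n : nat) (arc : rel 'I_n).
Hypothesis arcT : tournament arc.

Definition cyc3 x y z := [&& arc x y, arc y z & arc z x].

(** Rotating a directed triangle through [j] makes it start at [j], so one cyclic order covers all
    triangles. *)
Definition blocked (A : {set 'I_n}) j :=
  [exists a in A, exists b in A, cyc3 j a b].

Definition transitive_on (A : {set 'I_n}) := [forall j in A, ~~ blocked A j].

Definition maximal_below k (Y : {set 'I_n}) :=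
  [&& [forall x in Y, x < k], transitive_on Y
    & [forall j : 'I_n, (k <= j) || (j \in Y) || blocked Y j]].

Lemma arc_irr x : arc x x = false.
Proof. by case: arcT => + _; apply. Qed.

Lemma arcN x y : x != y -> arc y x = ~~ arc x y.
Proof. by case: arcT => _ /[apply]; case: (arc x y); case: (arc y x). Qed.

Lemma arc_asym x y : arc x y -> arc y x = false.
Proof.
move=> xy; have ne : x != y by apply: contraTneq xy => ->; rewrite arc_irr.
by rewrite arcN // xy.
Qed.

Lemma arc_trans_cyc3 x y z : arc x y -> arc y z -> ~~ cyc3 x y z -> arc x z.
Proof.
move=> xy yz; rewrite /cyc3 xy yz /= => zx.
have ne : z != x by apply: contraTneq yz => ->; rewrite arc_asym.
by rewrite arcN.
Qed.

Lemma cyc3_rot x y z : cyc3 x y z = cyc3 y z x.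
Proof. by rewrite /cyc3; case: arc; case: arc; case: arc. Qed.

Lemma blockedP (A : {set 'I_n}) j :
  reflect (exists a b, [/\ a \in A, b \in A & cyc3 j a b]) (blocked A j).
Proof.
apply: (iffP exists_inP) => [[a aA /exists_inP[b bA c]]|[a [b [aA bA c]]]].
  by exists a, b.
by exists a => //; apply/exists_inP; exists b.
Qed.

Lemma blockedS (A B : {set 'I_n}) j : A \subset B -> blocked A j -> blocked B j.
Proof.
move=> /subsetP sAB /blockedP[a [b [aA bA c]]].
by apply/blockedP; exists a, b; rewrite !sAB.
Qed.

Lemma transitive_onP (A : {set 'I_n}) :
  reflect {in A & & , forall x y z, ~~ cyc3 x y z} (transitive_on A).
Proof.
apply: (iffP forall_inP) => [tA x y z xA yA zA|tA j jA].
  by apply: contraNN (tA x xA) => c; apply/blockedP; exists y, z.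
by apply/blockedP => -[a [b [aA bA]]]; apply/negP/tA.
Qed.

Lemma transitive_onS (A B : {set 'I_n}) :
  A \subset B -> transitive_on B -> transitive_on A.
Proof.
move=> /subsetP sAB /transitive_onP tB; apply/transitive_onP => x y z xA yA zA.
by apply: tB; apply: sAB.
Qed.

Lemma transitive_onU1 (A : {set 'I_n}) j :
  transitive_on A -> ~~ blocked A j -> transitive_on (j |: A).
Proof.
move=> /transitive_onP tA nb.
have Nc a b : a \in j |: A -> b \in j |: A -> ~~ cyc3 j a b.
  case/setU1P=> [->|aA]; first by rewrite /cyc3 arc_irr.
  case/setU1P=> [->|bA]; first by rewrite /cyc3 arc_irr !andbF.
  by apply: contraNN nb => c; apply/blockedP; exists a, b.
apply/transitive_onP => x y z xA yA zA.
case/setU1P: (xA) => [->|xA']; first exact: Nc.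
case/setU1P: (yA) => [->|yA']; first by rewrite cyc3_rot; apply: Nc.
case/setU1P: (zA) => [->|zA']; first by rewrite -cyc3_rot; apply: Nc.
exact: tA.
Qed.

(** A directed triangle is itself a cycle. Conversely, without triangles [arc] is transitive on [A],
    so a cycle through [x] would contract to a loop at [x]. *)
Lemma acyclic_onP (A : {set 'I_n}) : acyclic_on arc A <-> transitive_on A.
Proof.
split=> [acA|/transitive_onP tA c sc /andP[cyc _]].
  apply/transitive_onP => x y z xA yA zA; apply/negP => /and3P[xy yz zx].
  suff: [:: x; y; z] = [::] by [].
  apply: acA.
    by move=> w; rewrite !inE => /or3P[]/eqP->.
  rewrite /ucycle /= xy yz zx /= !inE.
  have ne a b : arc a b -> a != b.
    by move=> ab; apply: contraTneq ab => ->; rewrite arc_irr.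
  by rewrite negb_or (ne x y) ?(ne y z) // eq_sym (ne z x).
case: c sc cyc => // x p sc /= cyc; exfalso.
have trA : {in A & & , transitive arc}.
  move=> y x' z yA xA zA xy yz.
  by apply: arc_trans_cyc3 xy yz (tA _ _ _ _ _ _).
have all_A : all [in A] (x :: rcons p x).
  by apply/allP => w; rewrite inE mem_rcons !inE orbA orbb => ?; apply: sc;
     rewrite inE.
have := order_path_min_in trA all_A cyc.
by rewrite all_rcons arc_irr.
Qed.

Lemma maximal_belowP k (Y : {set 'I_n}) : reflect
  [/\ forall x : 'I_n, x \in Y -> x < k, transitive_on Y
    & forall j : 'I_n, j < k -> j \notin Y -> blocked Y j] (maximal_below k Y).
Proof.
apply: (iffP and3P) => -[].
  move=> /forall_inP lt tY /forallP mY; split=> // j jk jY.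
  by have := mY j; rewrite leqNgt jk (negPf jY).
move=> lt tY mY; split=> //; first exact/forall_inP.
by apply/forallP => j; case: leqP => //= jk; case: (boolP (j \in Y)) => //= /mY ->.
Qed.

(** A vertex of [Z] outside [Y] would be blocked by [Y], hence by [Z]. This lifts maximality from
    single vertices to arbitrary transitive supersets. *)
Lemma maximal_below_max k (Y Z : {set 'I_n}) :
  maximal_below k Y -> Y \subset Z -> transitive_on Z ->
  (forall x : 'I_n, x \in Z -> x < k) -> Y = Z.
Proof.
case/maximal_belowP=> _ _ mY sYZ /forall_inP tZ ltZ; apply/eqP.
rewrite eqEsubset sYZ; apply/subsetP => x xZ; apply: contraTT (tZ x xZ) => xY.
by rewrite negbK; apply: blockedS sYZ _; exact: mY (ltZ _ xZ) xY.
Qed.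

(** Removing [j] from [F] adds [j] to the complement, and transitivity is hereditary, so minimality
    can be tested one vertex at a time. *)
Lemma minimal_fvsP (F : {set 'I_n}) :
  minimal_fvs arc F <-> maximal_below n (~: F).
Proof.
split=> [[/acyclic_onP tF minF]|/maximal_belowP[_ tF mF]].
  apply/maximal_belowP; split=> // j _.
  rewrite inE negbK => jF; apply: contraT => nb; exfalso.
  apply: (minF (F :\ j)); first exact: properD1.
  apply/acyclic_onP; suff -> : ~: (F :\ j) = j |: ~: F by apply: transitive_onU1.
  by apply/setP => x; rewrite !inE negb_and negbK.
split; first exact/acyclic_onP.
move=> G /properP[sGF [j jF jG]] /acyclic_onP /forall_inP tG.
have jG' : j \in ~: G by rewrite inE.
have/negP := tG _ jG'; apply.
by apply: (@blockedS (~: F)); rewrite ?setCS //; apply: mF => //; rewrite inE negbK.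
Qed.

(** * Candidates, and the parent as a greedy completion *)

Definition adj x y := nth 0 (encode arc) (1 + x * n + y) != 0.

(** A candidate is a plain number, possibly too large to be a vertex. *)
Definition natmem (X : {set 'I_n}) c := [exists x in X, val x == c].

(* A candidate [c < k] stands for the pivot [c], to be an in-neighbour of [k] in
   [X]: [k] is inserted just after [c], and since the pivot is the last
   in-neighbour of [k] in the result, different pivots give different sets.
   [c = k] inserts [k] first, [c = k + 1] leaves [X] unchanged. *)
Definition cand (X : {set 'I_n}) k c :=
  [set x : 'I_n | (x == k :> nat) && (c <= k) ||
     (x \in X) && ((c == k.+1) || (adj k x == ((c == k) || adj c x)))].

(* [X] is the greedy completion of [Y] minus [k]: a rejected [j] is blocked by
   the part of [Y] below [k] and the vertices accepted before [j]. *)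
Definition is_child (X Y : {set 'I_n}) k := [forall j : 'I_n,
  (k <= j) || (j \in X) || blocked [set x in X | (x \in Y) || (x < j)] j].

Definition accepted (X : {set 'I_n}) k c :=
  [&& (c < k) ==> natmem X c && adj c k,
      [forall j : 'I_n, (k < j) || (j \in cand X k c) || blocked (cand X k c) j]
    & is_child X (cand X k c) k].

Lemma adj_arc (x y : 'I_n) : adj x y = arc x y.
Proof.
have := nth_allpairs (fun a b => nat_of_bool (arc a b)) (s := enum 'I_n)
  (t := enum 'I_n) x y 0 (i := x) (j := y).
rewrite size_enum_ord !nth_ord_enum /adj /= add0n => ->//.
by case: (arc x y).
Qed.

Lemma natmemE (X : {set 'I_n}) (x : 'I_n) : natmem X x = (x \in X).
Proof.
apply/exists_inP/idP => [[y yX /eqP/val_inj<-]//|xX].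
by exists x.
Qed.

Lemma is_childP (X Y : {set 'I_n}) k : reflect
  (forall j : 'I_n, j < k -> j \notin X ->
    blocked [set x in X | (x \in Y) || (x < j)] j) (is_child X Y k).
Proof.
apply: (iffP forallP) => [H j jk jX|H j].
  by have := H j; rewrite leqNgt jk (negPf jX).
by case: leqP => //= jk; case: (boolP (j \in X)) => //= /H->.
Qed.

(** Start from the part of [Y] below [k] and scan the vertices in increasing order, adding each one
    that is not blocked by the set built so far. *)
Lemma parent_exists (Y : {set 'I_n}) k : transitive_on Y -> k <= n ->
  exists X : {set 'I_n}, [/\ transitive_on X, forall x : 'I_n, x \in X -> x < k,
    forall x : 'I_n, x \in Y -> x < k -> x \in X & is_child X Y k].
Proof.
move=> tY kn.
(* The extra clause bounds the set built so far by [Y] and the vertices already scanned, which is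
   where [is_child] looks for blocking pairs. *)
suff [X [tX ltX sYX _ cX]] : exists X : {set 'I_n},
    [/\ transitive_on X, forall x : 'I_n, x \in X -> x < k,
    forall x : 'I_n, x \in Y -> x < k -> x \in X,
    forall x : 'I_n, x \in X -> (x \in Y) || (x < k)
    & is_child X Y k] by exists X.
(* Only the scanning position varies; the range below [k] in the second and third clauses stays
   fixed. *)
elim: {1 5 6}k (leqnn k) => [|i IHi] ik.
  exists [set x in Y | x < k]; split=> [|x|x xY xk|x|].
  - by apply: transitive_onS tY; apply/subsetP => x; rewrite inE => /andP[].
  - by rewrite inE => /andP[].
  - by rewrite inE xY.
  - by rewrite inE => /andP[->].
  - exact/is_childP.
have [X [tX ltX sYX sXY /is_childP cX]] := IHi (ltnW ik).
pose v : 'I_n := Ordinal (leq_trans ik kn).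
have [/orP vX|] := boolP ((v \in X) || blocked X v).
  exists X; split=> // [x /sXY/orP[->|/ltnW xi]//|]; first by rewrite ltnS xi orbT.
  apply/is_childP => j; rewrite ltnS leq_eqVlt => /predU1P[ji|]; last exact: cX.
  have {ji} -> : j = v by apply: val_inj.
  case: vX => [->//|bX _]; apply: blockedS bX; apply/subsetP => x xX.
  by rewrite inE xX sXY.
rewrite negb_or => /andP[vX nb]; exists (v |: X); split.
- exact: transitive_onU1.
- by move=> x /setU1P[->//|/ltX].
- by move=> x xY xk; rewrite inE sYX ?orbT.
- move=> x /setU1P[->|/sXY/orP[->//|/ltnW xi]]; first by rewrite ltnSn orbT.
  by rewrite ltnS xi orbT.
apply/is_childP => j; rewrite ltnS leq_eqVlt => /predU1P[ji|ji].
  have -> : j = v by apply: val_inj.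
  by rewrite setU11.
rewrite !inE negb_or => /andP[_ /(cX j ji)]; apply: blockedS; apply/subsetP => x.
by rewrite !inE => /andP[-> ->]; rewrite orbT.
Qed.

(** Induction along the scan: if only one set contained [x], then [x] would be blocked in the other
    by vertices of [Y] or vertices before [x]. These lie in the first set as well, against its
    transitivity. *)
Lemma parent_unique (X X' Y : {set 'I_n}) k :
  maximal_below k X -> maximal_below k X' ->
  (forall x : 'I_n, x \in Y -> x < k -> x \in X) ->
  (forall x : 'I_n, x \in Y -> x < k -> x \in X') ->
  is_child X Y k -> is_child X' Y k -> X = X'.
Proof.
move=> mX mX' sX sX' /is_childP cX /is_childP cX'.
suff agree i : forall x : 'I_n, x < i -> (x \in X) = (x \in X').
  by apply/setP => x; apply: agree (ltn_ord x).
elim: i => // i IHi x; rewrite ltnS leq_eqVlt => /predU1P[xi|]; last exact: IHi.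
have half (A A' : {set 'I_n}) : maximal_below k A -> maximal_below k A' ->
    (forall x : 'I_n, x \in Y -> x < k -> x \in A) ->
    (forall j : 'I_n, j < k -> j \notin A' ->
      blocked [set x in A' | (x \in Y) || (x < j)] j) ->
    (forall y : 'I_n, y < x -> y \in A' -> y \in A) ->
    x \in A -> x \in A'.
  move=> /maximal_belowP[ltA /forall_inP tA _] /maximal_belowP[ltA' _ _] sA cA' eA xA.
  apply: contraTT (tA x xA) => /(cA' x (ltA x xA)); rewrite negbK.
  apply: blockedS; apply/subsetP => y; rewrite inE => /andP[yA' /orP[yY|]].
    by apply: sA => //; apply: ltA'.
  by move/eA; apply.
apply/idP/idP; apply: half => //= y; rewrite xi => /IHi->//.
Qed.

Lemma cand_lt (X : {set 'I_n}) k c (x : 'I_n) :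
  (forall x : 'I_n, x \in X -> x < k) ->
  x \in cand X k c -> x < k.+1.
Proof.
move=> ltX; rewrite inE => /orP[/andP[/eqP-> _]//|/andP[/ltX xk _]].
exact: ltnW.
Qed.

Lemma cand_sub (X : {set 'I_n}) k c (x : 'I_n) :
  x \in cand X k c -> x < k -> x \in X.
Proof. by rewrite inE => /orP[/andP[/eqP-> _]|/andP[]//]; rewrite ltnn. Qed.

Lemma cand_stay (X : {set 'I_n}) k : cand X k k.+1 = X.
Proof. by apply/setP => x; rewrite inE ltnn andbF eqxx andbT. Qed.

Lemma candE (X : {set 'I_n}) (v : 'I_n) c : c <= v ->
  cand X v c = v |: [set x in X | arc v x == ((c == v) || adj c x)].
Proof.
move=> cv; apply/setP => x.
by rewrite !inE cv andbT adj_arc (ltn_eqF (_ : c < v.+1)).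
Qed.

(** With a pivot [u], the kept vertices see [u] as they see [v], so a triangle [v a b] would give
    the triangle [u a b] inside [X]. With [c = v] only out-neighbours of [v] are kept, so no arc
    returns to [v]. *)
Lemma cand_transitive (X : {set 'I_n}) (v : 'I_n) c : transitive_on X ->
  (c < v) ==> natmem X c && adj c v -> c <= v.+1 -> transitive_on (cand X v c).
Proof.
move=> tX val_c; rewrite leq_eqVlt => /predU1P[->|]; first by rewrite cand_stay.
rewrite ltnS => cv; rewrite candE //; apply: transitive_onU1.
  by apply: transitive_onS tX; apply/subsetP => x; rewrite inE => /andP[].
apply/blockedP => -[a [b []]]; rewrite !inE /cyc3.
move=> /andP[aX /eqP va'] /andP[bX /eqP vb'] /and3P[va ab bv].
move: va' vb'; rewrite va (arc_asym bv) => va' vb'.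
case: (ltngtP c v) va' vb' val_c cv => //= cv ua ub /andP[uX _] _.
case/exists_inP: uX => u uX /eqP uc; move: ua ub; rewrite -uc !adj_arc => ua ub.
have ne : b != u by apply: contraTneq ab => ->; rewrite arc_asym.
move/transitive_onP: tX => /(_ u a b uX aX bX); rewrite /cyc3 -ua ab /=.
by rewrite arcN -?ub // eq_sym.
Qed.

(** Membership of [v] singles out [c = v.+1]. A pivot is an in-neighbour of [v] that is kept, while
    [c = v] keeps none. Two pivots of the same set have no arc in either direction, so they
    coincide. *)
Lemma cand_inj (X : {set 'I_n}) (v : 'I_n) c c' : c <= v.+1 -> c' <= v.+1 ->
  (c < v) ==> natmem X c && adj c v -> (c' < v) ==> natmem X c' && adj c' v ->
  (forall x : 'I_n, x \in X -> x < v) ->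
  cand X v c = cand X v c' -> c = c'.
Proof.
move=> cv c'v vc vc' ltX E.
have memv b : b <= v.+1 -> (v \in cand X v b) = (b <= v).
  move=> bv; rewrite inE eqxx /=; case: leqP => //= vb.
  by apply/negP => /andP[/ltX]; rewrite ltnn.
have piv b : (b < v) ==> natmem X b && adj b v -> b < v ->
    exists2 u : 'I_n, val u = b & [/\ u \in X, arc u v & u \in cand X v b].
  move=> + bv; rewrite bv /= => /andP[/exists_inP[u uX /eqP ub]].
  move: bv; rewrite -ub adj_arc => bv uv; exists u => //; split=> //.
  rewrite candE ?(ltnW bv) // !inE uX adj_arc (arc_asym uv) arc_irr.
  by rewrite (ltn_eqF bv) orbT.
have eqv : (c <= v) = (c' <= v) by rewrite -!memv // E.
have one b : (b < v) ==> natmem X b && adj b v -> b < v ->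
    cand X v b = cand X v v -> False.
  move=> vb bv Eb; have [u ub [uX uv]] := piv _ vb bv.
  rewrite Eb candE // !inE eqxx uX /= (arc_asym uv) orbF => /eqP uv'.
  by move: uv; rewrite uv' arc_irr.
case: (ltngtP c v) eqv => [cltv|vltc|ceq].
- case: (ltngtP c' v) => [c'ltv _|//|c'eq _].
    have [u uc [uX uv uE]] := piv _ vc cltv.
    have [u' uc' [u'X u'v u'E]] := piv _ vc' c'ltv.
    have half (w w' : 'I_n) : w < v -> w' < v -> arc w' v ->
        w' \in cand X v w -> arc w w' = false.
      move=> wv w'v av; rewrite candE ?(ltnW wv) // !inE adj_arc (arc_asym av).
      rewrite (ltn_eqF wv) /= => /orP[/eqP ww'|/andP[_ /eqP]//].
      by move: w'v; rewrite ww' ltnn.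
    have uv' : u < v by rewrite uc.
    have u'v' : u' < v by rewrite uc'.
    have uu' : arc u u' = false by apply: half => //; rewrite uc E.
    have u'u : arc u' u = false by apply: half => //; rewrite uc' -E.
    rewrite -uc -uc'; apply: contraTeq isT => ne.
    by have := arcN ne; rewrite uu' u'u.
  by have := one _ vc cltv; rewrite E {1}c'eq => /(_ erefl).
- case: (ltngtP c' v) => // vltc' _.
  by apply/eqP; rewrite eqn_leq (leq_trans cv) ?(leq_trans c'v).
case: (ltngtP c' v) => // [c'ltv _|-> //].
by have := one _ vc' c'ltv; rewrite -E ceq => /(_ erefl).
Qed.


(** Maximality is part of the test; transitivity comes from the shape of the candidate. *)
Lemma cand_maximal (X : {set 'I_n}) k c : k < n -> c < k.+2 ->
  maximal_below k X -> accepted X k c -> maximal_below k.+1 (cand X k c).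
Proof.
move=> kn ck /maximal_belowP[ltX tX _] /and3P[vc mc _]; apply/and3P; split=> //.
  by apply/forall_inP => x; apply: cand_lt.
by apply: (@cand_transitive X (Ordinal kn) c).
Qed.

(** Take [u] of largest in-degree within [A]: an arc from [u] to [y] would give [y] all
    in-neighbours of [u] and [u] itself. *)
Lemma sink_exists (A : {set 'I_n}) x : transitive_on A -> x \in A ->
  exists2 u, u \in A & {in A, forall y, arc u y = false}.
Proof.
move=> /transitive_onP tA xA.
pose indeg u := #|[set y in A | arc y u]|.
case: (@arg_maxnP _ x (mem A) indeg xA) => u uA umax; exists u => // y yA.
apply: contraTF (umax y yA) => uy; rewrite -ltnNge; apply: proper_card.
apply/properP; split; last first.
  by exists u; rewrite inE (uA : u \in A) ?uy ?arc_irr.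
apply/subsetP => z; rewrite !inE => /andP[zA zu]; rewrite zA.
exact: arc_trans_cyc3 zu uy (tA _ _ _ _ _ _).
Qed.

(** Completeness of the candidates: [X] is the greedy parent of [Y], and [c] is read off from the
    place of [k] in the linear order of [Y]. *)
Lemma accepted_complete (Y : {set 'I_n}) k : k < n -> maximal_below k.+1 Y ->
  exists X c, [/\ c < k.+2, maximal_below k X, accepted X k c & cand X k c = Y].
Proof.
move=> kn mY; have /maximal_belowP[ltY tY bY] := mY.
have [X [tX ltX sYX cX]] := parent_exists tY (ltnW kn).
have mX : maximal_below k X.
  apply/maximal_belowP; split=> // j jk jX.
  apply: blockedS (is_childP _ _ _ cX j jk jX).
  by apply/subsetP => x; rewrite inE => /andP[].
(* One inclusion suffices, since the candidate is transitive and [Y] is maximal. *)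
suff [c [ck vc sYc]] : exists c, [/\ c < k.+2, (c < k) ==> natmem X c && adj c k
    & Y \subset cand X k c].
  have Yc : cand X k c = Y.
    apply/esym/(maximal_below_max mY) => //; last by move=> x; apply: cand_lt.
    exact: (@cand_transitive X (Ordinal kn) c).
  exists X, c; split=> //; rewrite /accepted Yc vc cX andbT /=.
  by case/and3P: mY.
pose v := Ordinal kn.
have lt_neq x : x \in Y -> x != v -> x < k.
  move=> xY xv; have := ltY x xY; rewrite ltnS leq_eqVlt => /predU1P[xk|//].
  by case/eqP: xv; apply: val_inj.
have [vY|vY] := boolP (v \in Y); last first.
  exists k.+1; split=> //; first by rewrite ltnNge leqnSn.
  rewrite cand_stay; apply/subsetP => x xY; apply: sYX (xY) _.
  by apply: lt_neq => //; apply: contraNneq vY => <-.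
have [/eqP P0|[w wP]] := set_0Vmem [set x in Y | arc x v].
  exists k; split=> //; first by rewrite ltnn.
  rewrite (@candE X v) //; apply/subsetP => x xY; rewrite !inE.
  have [//|xv] := eqVneq x v; rewrite sYX ?lt_neq //= eqxx /= eqb_id arcN //.
  by apply: contraL P0 => xv'; apply/set0Pn; exists x; rewrite inE xY.
have tP : transitive_on [set x in Y | arc x v].
  by apply: transitive_onS tY; apply/subsetP => x; rewrite inE => /andP[].
(* The pivot is the last in-neighbour of [v] in [Y]. *)
have [u] := sink_exists tP wP; rewrite inE => /andP[uY uv] sink_u.
have uk : u < k.
  by apply: lt_neq => //; apply: contraTneq uv => ->; rewrite arc_irr.
exists u; split; first by rewrite ltnS ltnW // ltnW.
  by rewrite uk natmemE sYX //= (adj_arc u v).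
rewrite (@candE X v) ?(ltnW uk) //; apply/subsetP => x xY; rewrite !inE.
have [//|xv] := eqVneq x v.
rewrite sYX ?lt_neq //= (ltn_eqF uk) adj_arc /=; apply/eqP.
(* An out-neighbour of [v] is one of [u] by transitivity; an in-neighbour of [v] receives no arc
   from the sink [u]. *)
have [vx|vx] := boolP (arc v x).
  by rewrite (arc_trans_cyc3 uv vx) //; move/transitive_onP: tY; apply.
by rewrite sink_u // inE xY arcN // eq_sym.
Qed.

(** Extend [X] to a maximal set [Y] one level up, by adding [k] if possible. The parent of [Y]
    contains [X], hence equals it by maximality. *)
Lemma accepted_exists X k : k < n -> maximal_below k X ->
  exists2 c, c < k.+2 & accepted X k c.
Proof.
move=> kn mX; have /maximal_belowP[ltX tX bX] := mX.
pose v := Ordinal kn.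
suff [Y mY sXY] : exists2 Y, maximal_below k.+1 Y & X \subset Y.
  have [X' [c [ck mX' aX' eY]]] := accepted_complete kn mY.
  exists c => //; suff -> : X = X' by [].
  have /maximal_belowP[ltX' tX' _] := mX'.
  apply: maximal_below_max mX _ tX' ltX'; apply/subsetP => x xX.
  by apply: (@cand_sub _ k c); rewrite ?ltX // eY (subsetP sXY).
have [bv|bv] := boolP (blocked X v).
  exists X => //; apply/maximal_belowP; split=> // [x /ltX/ltnW//|j].
  rewrite ltnS leq_eqVlt => /predU1P[jk|]; last exact: bX.
  by have -> : j = v by apply: val_inj.
exists (v |: X); last exact: subsetU1.
apply/maximal_belowP; split; last 1 first.
- move=> j; rewrite ltnS leq_eqVlt => /predU1P[jk|jk].
    have -> : j = v by apply: val_inj.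
    by rewrite setU11.
  rewrite !inE negb_or => /andP[_ /(bX j jk)]; apply: blockedS; exact: subsetU1.
- by move=> x /setU1P[->//|/ltX/ltnW].
exact: transitive_onU1.
Qed.

(** * The search tree and its leaves, with [f] the number of levels left *)

Fixpoint leaves f k X : seq {set 'I_n} :=
  if f is f'.+1 then
    flatten [seq leaves f' k.+1 (cand X k c) | c <- iota 0 k.+2 & accepted X k c]
  else [:: X].

Lemma leavesP f k X L : reflect
  (exists c, [/\ c < k.+2, accepted X k c & L \in leaves f k.+1 (cand X k c)])
  (L \in leaves f.+1 k X).
Proof.
apply: (iffP flatten_mapP) => [[c]|[c [ck ac Lc]]].
  by rewrite mem_filter mem_iota => /andP[ac /= ck] Lc; exists c.
by exists c => //; rewrite mem_filter mem_iota ac.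
Qed.

Lemma leaves_maximal f k X L : f + k = n -> maximal_below k X ->
  L \in leaves f k X -> maximal_below n L.
Proof.
elim: f k X => [|f IHf] k X fk mX; first by rewrite inE => /eqP->; rewrite -fk.
case/leavesP=> c [ck ac]; apply: IHf; first by rewrite addnS -addSn.
by apply: cand_maximal => //; rewrite -fk addSn ltnS leq_addl.
Qed.

(** Climbing from a common leaf, both paths meet the same node at each level because parents are
    unique. *)
Lemma leaves_parent f k X X' L : f + k = n ->
  maximal_below k X -> maximal_below k X' ->
  L \in leaves f k X -> L \in leaves f k X' -> X = X'.
Proof.
elim: f k X X' => [|f IHf] k X X' fk mX mX'.
  by rewrite !inE => /eqP<- /eqP<-.
have kn : k < n by rewrite -fk addSn ltnS leq_addl.
case/leavesP=> c [ck ac Lc] /leavesP[c' [ck' ac' Lc']].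
have E : cand X k c = cand X' k c'.
  by apply: IHf Lc Lc'; rewrite ?cand_maximal // addnS -addSn.
case/and3P: ac => _ _ pX; case/and3P: ac'; rewrite -E => _ _ pX'.
apply: parent_unique mX mX' _ _ pX pX' => x; first exact: cand_sub.
by rewrite E; apply: cand_sub.
Qed.

(** Distinct accepted candidates give distinct children by [cand_inj], and distinct children have
    disjoint sets of leaves. *)
Lemma leaves_uniq f k X : f + k = n -> maximal_below k X ->
  uniq (leaves f k X).
Proof.
elim: f k X => [//|f IHf] k X fk mX.
have kn : k < n by rewrite -fk addSn ltnS leq_addl.
have fk' : f + k.+1 = n by rewrite addnS -addSn.
rewrite /leaves -/leaves.
have: uniq [seq c <- iota 0 k.+2 | accepted X k c].
  by rewrite filter_uniq ?iota_uniq.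
have: {subset [seq c <- iota 0 k.+2 | accepted X k c] <=
       [pred c | (c < k.+2) && accepted X k c]}.
  by move=> c; rewrite mem_filter mem_iota !inE andbC.
elim: (filter _ _) => //= c s IHs sub /andP[cs us].
have /andP[ck ac] := sub c (mem_head _ _).
rewrite cat_uniq IHf ?cand_maximal //= IHs //; last first.
  by move=> d ds; apply: sub; rewrite inE ds orbT.
rewrite andbT; apply/hasPn => L /flatten_mapP[d ds Ld].
apply: contra cs => Lc.
have /andP[dk ad] : d \in [pred c | (c < k.+2) && accepted X k c].
  by apply: sub; rewrite inE ds orbT.
have E : cand X k c = cand X k d.
  by apply: leaves_parent Lc Ld; rewrite ?cand_maximal.
have /maximal_belowP[ltX _ _] := mX.
case/and3P: ac ad => vc _ _ /and3P[vd _ _].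
by rewrite (cand_inj (v := Ordinal kn) ck dk vc vd ltX E).
Qed.

(** Climb from parent to parent; the only maximal set at level 0 is empty. *)
Lemma leaves_root f k X L : f + k = n -> maximal_below k X ->
  L \in leaves f k X -> L \in leaves n 0 set0.
Proof.
elim: k f X => [|k IHk] f X fk mX LX.
  suff <- : X = set0 by rewrite -[X in leaves X 0]fk addn0.
  case/maximal_belowP: mX => ltX _ _; apply/setP => x; rewrite inE.
  by apply/negP => /ltX.
have kn : k < n by rewrite -fk leq_addl.
have [X' [c [ck mX' ac' E]]] := accepted_complete kn mX.
apply: (IHk f.+1) mX' _; first by rewrite addSn -addnS.
by apply/leavesP; exists c; rewrite E.
Qed.

Lemma maximal_below0 : maximal_below 0 set0.
Proof.
apply/maximal_belowP; split=> // [x|]; first by rewrite inE.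
by apply/transitive_onP => x y z; rewrite inE.
Qed.

Lemma mem_leaves L : L \in leaves n 0 set0 <-> minimal_fvs arc (~: L).
Proof.
split=> [LX|/minimal_fvsP]; last first.
  by rewrite setCK => mL; apply: leaves_root (add0n n) mL _; rewrite inE.
apply/minimal_fvsP; rewrite setCK.
by apply: leaves_maximal maximal_below0 LX; rewrite addn0.
Qed.

(** The heart of the delay bound: every visited subtree produces output. *)
Lemma leaves_nonempty f k X : f + k = n -> maximal_below k X ->
  leaves f k X != [::].
Proof.
elim: f k X => [//|f IHf] k X fk mX.
have kn : k < n by rewrite -fk addSn ltnS leq_addl.
have [c ck ac] := accepted_exists kn mX.
have : leaves f k.+1 (cand X k c) != [::].
  by rewrite IHf ?cand_maximal // addnS -addSn.
case E : (leaves f _ _) => [//|L s] _.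
suff : L \in leaves f.+1 k X by apply: contraTneq => ->.
by apply/leavesP; exists c; rewrite E mem_head.
Qed.

End Transitive.

(** * Time- and space-bounded triples for while programs *)

Definition truthy m e := eval m e != 0.

Definition var v := Read v (Const 0).
Definition Or := Plus.
Definition Not e := Minus (Const 1) e.
Definition And e f := Not (Or (Not e) (Not f)).
Definition Iff e f := Or (And e f) (And (Not e) (Not f)).
Definition Lt e f := Minus f e.
Definition Eq e f := Not (Or (Lt e f) (Lt f e)).

Lemma truthyOr m e f : truthy m (Or e f) = truthy m e || truthy m f.
Proof. by rewrite /truthy /= addn_eq0 negb_and. Qed.

Lemma truthyNot m e : truthy m (Not e) = ~~ truthy m e.
Proof. by rewrite /truthy /=; case: (eval m e). Qed.

Lemma truthyAnd m e f : truthy m (And e f) = truthy m e && truthy m f.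
Proof. by rewrite !(truthyNot, truthyOr) negb_or !negbK. Qed.

Lemma truthyIff m e f : truthy m (Iff e f) = (truthy m e == truthy m f).
Proof.
by rewrite !(truthyOr, truthyAnd, truthyNot); case: truthy; case: truthy.
Qed.

Lemma truthyLt m e f : truthy m (Lt e f) = (eval m e < eval m f).
Proof. by rewrite /truthy /= subn_eq0 ltnNge. Qed.

Lemma truthyEq m e f : truthy m (Eq e f) = (eval m e == eval m f).
Proof. by rewrite truthyNot truthyOr !truthyLt -neq_ltn negbK. Qed.

Definition truthyE :=
  (truthyNot, truthyAnd, truthyIff, truthyEq, truthyLt, truthyOr).

Lemma eval_Not m e : eval m (Not e) = ~~ truthy m e.
Proof. by rewrite /truthy /=; case: (eval m e). Qed.

Lemma read_write m a i v b j :
  read (write m a i v) b j = if (b == a) && (j == i) then v else read m b j.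
Proof.
by rewrite /read /write nth_set_nth /=; case: eqP => //= ->; rewrite nth_set_nth.
Qed.

(** Any constant above 11, the largest array name in the program. *)
Definition arrays := 16.

Definition fits B (m : memory) := [/\ size m <= arrays,
  forall a, size (nth [::] m a) <= B & forall a i, read m a i <= B].

Lemma fits_write B m a i v : fits B m -> a < arrays -> i < B -> v <= B ->
  fits B (write m a i v).
Proof.
move=> [sm sa sv] lta ltib vb; split=> [|b|b j].
- by rewrite size_set_nth geq_max lta.
- rewrite nth_set_nth /=; case: eqP => // _.
  by rewrite size_set_nth geq_max ltib sa.
- by rewrite read_write; case: ifP.
Qed.

Lemma sum_seq_le (T : Type) (x0 : T) (s : seq T) F b :
  (forall i, F (nth x0 s i) <= b) -> \sum_(x <- s) F x <= size s * b.
Proof.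
elim: s => [|x s IHs] Fb; first by rewrite big_nil.
by rewrite big_cons mulSn leq_add ?(Fb 0) // IHs // => i; apply: (Fb i.+1).
Qed.

(** The bit length of [v] is bounded crudely by [v.+1], which is enough because all stored values
    are polynomial. *)
Lemma fits_space B s : fits B (store s) -> space_used s <= arrays * (B * B.+1).
Proof.
case: s => k m o /= [sm sa sv]; rewrite /space_used /=.
apply: leq_trans (leq_mul sm (leqnn _)); apply: (sum_seq_le (x0 := [::])) => a.
apply: leq_trans (leq_mul (sa a) (leqnn _)); apply: (sum_seq_le (x0 := 0)) => i.
have := sv a i; rewrite ltnS /read; apply: leq_trans.
case: (nth 0 _ i) => // v; apply/ltnW/(leq_trans (ltn_expl _ (ltnSn 1))).
exact: trunc_logP.
Qed.

(* Running time bound, if every loop makes at most [M] rounds. *)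
Fixpoint cost M c := match c with
  | Seq c1 c2 | If _ c1 c2 => 1 + cost M c1 + cost M c2
  | While _ c1 => 1 + M * (1 + cost M c1)
  | _ => 1
  end.

(** * Silent runs and rules for total correctness *)

Section Triples.

Variables M B : nat.
Implicit Types (m : memory) (o : seq nat) (Q : memory -> seq nat -> Prop).

(** The last configuration is exempt from the second clause: it may be about to execute [Emit]. *)
Definition silent t s s' := [/\ iter t step s = s',
  forall i, i < t -> emitted (iter i step s) = None
  & forall i, i <= t -> fits B (store (iter i step s))].

Lemma silent_trans t1 t2 s1 s2 s3 :
  silent t1 s1 s2 -> silent t2 s2 s3 -> silent (t1 + t2) s1 s3.
Proof.
move=> [e1 n1 f1] [e2 n2 f2]; split=> [|i lti|i lti].
- by rewrite addnC iterD e1.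
- have [lt1|le1] := ltnP i t1; first exact: n1.
  by rewrite -(subnK le1) iterD e1 n2 // ltn_subLR.
- have [lt1|le1] := leqP i t1; first exact: f1.
  by rewrite -(subnK (ltnW le1)) iterD e1; apply: f2; rewrite leq_subLR.
Qed.

Lemma silent0 s : fits B (store s) -> silent 0 s s.
Proof. by move=> fs; split=> // i; rewrite leqn0 => /eqP->. Qed.

Lemma silent1 s s' : step s = s' -> emitted s = None ->
  fits B (store s) -> fits B (store s') -> silent 1 s s'.
Proof. by move=> <- es fs fs'; split=> //; case=> [|[]]. Qed.

(** The continuation [K] is arbitrary, so that triples compose. Silence confines them to code that
    emits nothing; [Emit] is treated separately. *)
Definition wp c m o Q := exists t m' o', [/\ t <= cost M c, Q m' o', fits B m'
  & forall K, silent t (Config (c :: K) m o) (Config K m' o')].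

Lemma wp_conseq c m o Q Q' : wp c m o Q ->
  (forall m' o', fits B m' -> Q m' o' -> Q' m' o') -> wp c m o Q'.
Proof.
by move=> [t [m' [o' [tc q f s]]]] imp; exists t, m', o'; split=> //; apply: imp.
Qed.

Lemma wp_skip m o Q : fits B m -> Q m o -> wp Skip m o Q.
Proof. by move=> f q; exists 1, m, o; split=> // K; apply: silent1. Qed.

Lemma wp_write a i v m o Q : fits B m -> a < arrays -> eval m i < B ->
  eval m v <= B -> Q (write m a (eval m i) (eval m v)) o ->
  wp (Write a i v) m o Q.
Proof.
move=> f lta ib vb q; have fw := fits_write f lta ib vb.
by exists 1, (write m a (eval m i) (eval m v)), o; split=> // K; apply: silent1.
Qed.

Lemma wp_print e m o Q : fits B m -> Q m (rcons o (eval m e)) ->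
  wp (Print e) m o Q.
Proof.
by move=> f q; exists 1, m, (rcons o (eval m e)); split=> // K; apply: silent1.
Qed.

Lemma wp_seq c1 c2 m o Q : fits B m ->
  wp c1 m o (fun m1 o1 => fits B m1 -> wp c2 m1 o1 Q) -> wp (Seq c1 c2) m o Q.
Proof.
move=> f [t1 [m1 [o1 [l1 /[swap] f1 /(_ f1) [t2 [m2 [o2 [l2 q f2 s2]]]] s1]]]].
exists (1 + t1 + t2), m2, o2; split=> //= [|K]; first by rewrite !leq_add.
by apply: silent_trans (s2 K); apply: silent_trans (s1 _); apply: silent1.
Qed.

Lemma wp_if e c1 c2 m o Q : fits B m ->
  wp (if truthy m e then c1 else c2) m o Q -> wp (If e c1 c2) m o Q.
Proof.
move=> f [t [m' [o' [l q f' s]]]]; exists (1 + t), m', o'; split=> //= [|K].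
  by rewrite -addnA leq_add2l (leq_trans l) //; case: ifP; rewrite ?leq_addl ?leq_addr.
by apply: silent_trans (s K); apply: silent1.
Qed.

(** The invariant is indexed by the round, and [N] is the exact number of rounds, which gives
    termination and cost together. *)
Lemma wp_while e c N (I : nat -> memory -> seq nat -> Prop) m o :
  fits B m -> N <= M -> I 0 m o ->
  (forall i m o, i < N -> fits B m -> I i m o -> truthy m e /\ wp c m o (I i.+1)) ->
  (forall m o, I N m o -> truthy m e = false) ->
  wp (While e c) m o (I N).
Proof.
move=> f NM I0 Istep Iend.
suff loop j : j <= N -> exists t m' o', [/\ t <= j * (1 + cost M c), I j m' o',
    fits B m' & forall K, silent t (Config (While e c :: K) m o)
                                  (Config (While e c :: K) m' o')].
  have [t [m' [o' [lt Im' f' s]]]] := loop N (leqnn N).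
  exists (t + 1), m', o'; split=> //= [|K].
    by rewrite addnC leq_add2l (leq_trans lt) // leq_mul2r NM orbT.
  apply: silent_trans (s K) _; apply: silent1 => //=.
  by have := Iend _ _ Im'; rewrite /truthy => ->.
elim: j => [|j IHj] jN; first by exists 0, m, o; split=> // K; apply: silent0.
have [t [m1 [o1 [lt I1 f1 s]]]] := IHj (ltnW jN).
have [tr [t2 [m2 [o2 [lt2 I2 f2 s2]]]]] := Istep _ _ _ jN f1 I1.
exists (t + (1 + t2)), m2, o2; split=> // [|K].
  by rewrite mulSnr leq_add ?leq_add2l.
apply: silent_trans (s K) _; apply: silent_trans (s2 _).
by apply: silent1 => //=; move: tr; rewrite /truthy => ->.
Qed.

Definition Set_ v e := Write v (Const 0) e.

Definition For v e c := Seq (Set_ v (Const 0))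
  (While (Lt (var v) e) (Seq c (Set_ v (Plus (var v) (Const 1))))).

Lemma wp_for v e c N (I : nat -> memory -> seq nat -> Prop) m o :
  fits B m -> v < arrays -> N <= M -> N < B ->
  I 0 (write m v 0 0) o ->
  (forall i m o, i <= N -> I i m o -> read m v 0 = i /\ eval m e = N) ->
  (forall i m o, i < N -> fits B m -> I i m o ->
    wp c m o (fun m' o' => read m' v 0 = i /\ I i.+1 (write m' v 0 i.+1) o')) ->
  wp (For v e c) m o (I N).
Proof.
move=> f va NM NB I0 Ival Istep; have B0 : 0 < B by apply: leq_ltn_trans NB.
apply: wp_seq => //; apply: wp_write => // f0.
apply: wp_while => // [i {f0 I0 m o f} m o iN f Im|m' o' Im]; last first.
  by rewrite truthyLt /=; case: (Ival _ _ _ _ Im) => // -> ->; rewrite ltnn.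
rewrite truthyLt /=; case: (Ival _ _ _ (ltnW iN) Im) => -> ->; split=> //.
apply: wp_seq => //; apply: wp_conseq (Istep _ _ _ iN f Im) _.
move=> m' o' f' [rv Im'] _.
by apply: wp_write => //=; rewrite rv addn1 // (leq_trans iN) // ltnW.
Qed.

Definition frame (W : seq nat) m m' :=
  forall a, a \notin W -> forall i, read m' a i = read m a i.

(** Bounded existential search without early exit, so that [wp_for] applies with a fixed number of
    rounds. *)
Definition Any r v e c b := Seq (Set_ r (Const 0))
  (For v e (Seq c (If b (Set_ r (Const 1)) Skip))).

Lemma wp_any r v e c b N (phi : pred nat) W m o :
  fits B m -> r < arrays -> v < arrays -> N <= M -> N < B ->
  r != v -> r \notin W -> v \notin W ->
  (forall m', frame (r :: v :: W) m m' -> eval m' e = N) ->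
  (forall i m', i < N -> fits B m' -> frame (r :: v :: W) m m' ->
    read m' v 0 = i -> wp c m' o (fun m'' o' =>
      [/\ o' = o, frame W m' m'' & truthy m'' b = phi i])) ->
  wp (Any r v e c b) m o (fun m' o' => [/\ o' = o, frame (r :: v :: W) m m'
    & truthy m' (var r) = has phi (iota 0 N)]).
Proof.
move=> f ra va NM NB rv rW vW eN step_c; have B0 : 0 < B by apply: leq_ltn_trans NB.
apply: wp_seq => //; apply: wp_write => // f0 /=.
pose I i m' o' := [/\ o' = o, frame (r :: v :: W) m m', read m' v 0 = i
  & read m' r 0 = has phi (iota 0 i)].
have notin a : a \notin r :: v :: W -> [/\ a != r, a != v & a \notin W].
  by rewrite !inE !negb_or => /and3P.
apply: (@wp_conseq _ _ _ (I N)); last first.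
  by move=> m' o' _ [-> fr _ E]; split=> //; rewrite /truthy /= E eqb0 negbK.
apply: wp_for => // [|i m' o' _ [_ fr rdv _]|i m' o' iN f' [-> fr rdv E]].
- split=> // [a /notin[ar av _] i||]; rewrite !read_write ?eqxx ?andbF //.
    by rewrite (negPf ar) (negPf av).
  by rewrite (negPf rv).
- by rewrite eN.
apply: wp_seq => //; apply: wp_conseq (step_c i m' iN f' fr rdv) _.
move=> m1 o1 f1 [-> fr1 phi_i] _.
have has_i : has phi (iota 0 i.+1) = has phi (iota 0 i) || phi i.
  by rewrite -addn1 iotaD has_cat /= orbF add0n.
have fr2 : frame (r :: v :: W) m m1.
  by move=> a an j; rewrite fr1 ?fr //; case: (notin _ an).
apply: wp_if => //; rewrite phi_i; case: ifP => phi_iE.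
  apply: wp_write => //; split; last split=> //.
  - by rewrite read_write eq_sym (negPf rv) fr1.
  - move=> a an j; case: (notin _ an) => ar av _.
    by rewrite !read_write (negPf ar) (negPf av) /= fr2.
  - by rewrite read_write !eqxx.
  by rewrite !read_write !eqxx (negPf rv) has_i phi_iE orbT.
apply: wp_skip => //; split; last split=> //.
- by rewrite fr1.
- move=> a an j; case: (notin _ an) => ar av _.
  by rewrite read_write (negPf av) /= fr2.
- by rewrite read_write !eqxx.
by rewrite has_i read_write (negPf rv) fr1 // E phi_iE orbF.
Qed.

End Triples.

(** * Polynomially bounded functions *)

Definition poly_bounded (f : nat -> nat) :=
  exists p : {poly nat}, forall n, f n <= (p.[n])%R.

Lemma poly_boundedC c : poly_bounded (fun=> c).
Proof. by exists (c%:P)%R => n; rewrite hornerC. Qed.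

Lemma poly_boundedX : poly_bounded id.
Proof. by exists 'X%R => n; rewrite hornerX. Qed.

Lemma poly_boundedD f g :
  poly_bounded f -> poly_bounded g -> poly_bounded (fun n => f n + g n).
Proof.
by move=> [p fp] [q gq]; exists (p + q)%R => n; rewrite hornerD leq_add.
Qed.

Lemma poly_boundedM f g :
  poly_bounded f -> poly_bounded g -> poly_bounded (fun n => f n * g n).
Proof.
by move=> [p fp] [q gq]; exists (p * q)%R => n; rewrite hornerM leq_mul.
Qed.

Lemma poly_bounded_cost M c : poly_bounded M -> poly_bounded (fun n => cost (M n) c).
Proof.
move=> pM; elim: c => /=; try by move=> *; apply: poly_boundedC.
- by move=> c1 p1 c2 p2; do 2?[apply: poly_boundedD => //]; apply: poly_boundedC.
- by move=> _ c1 p1 c2 p2; do 2?[apply: poly_boundedD => //]; apply: poly_boundedC.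
move=> _ c p; apply: poly_boundedD; first exact: poly_boundedC.
by apply: poly_boundedM => //; apply: poly_boundedD => //; apply: poly_boundedC.
Qed.

(** * The program *)

(* Array [ADJ] is the input, so that its cell 0 holds [n]; [ROW] holds the
   offsets [1 + i * n] of the rows of [ADJ] and of [SET], whose row [k] is the
   set at level [k]; [CHOICE] holds the next candidate to try at each level;
   [DEPTH] is 1 + the current level. *)
Notation ADJ := 0 (only parsing).
Notation ROW := 1 (only parsing).
Notation SET := 2 (only parsing).
Notation CHOICE := 3 (only parsing).
Notation DEPTH := 4 (only parsing).
Notation IDX_J := 5 (only parsing).
Notation IDX_P := 6 (only parsing).
Notation IDX_Q := 7 (only parsing).
Notation FOUND_Q := 8 (only parsing).
Notation FOUND_P := 9 (only parsing).
Notation NOT_MAXIMAL := 10 (only parsing).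
Notation NOT_CHILD := 11 (only parsing).

Definition order_ := Read ADJ (Const 0).
Definition depth_ := var DEPTH.
Definition level_ := Minus depth_ (Const 1).
Definition choice_ := Read CHOICE level_.
Definition arc_ x y := Read ADJ (Plus (Read ROW x) y).
Definition inX_ x := Read SET (Plus (Read ROW level_) x).
Definition inY_ x := Read SET (Plus (Read ROW depth_) x).

(** The double [Not] turns the truth value into 0 or 1, keeping the stored numbers small. *)
Definition Build := For IDX_J order_ (Write SET (Plus (Read ROW depth_) (var IDX_J))
  (Not (Not (Or (And (Eq (var IDX_J) level_) (Not (Lt level_ choice_)))
    (And (inX_ (var IDX_J)) (Or (Eq choice_ depth_)
      (Iff (arc_ level_ (var IDX_J))
           (Or (Eq choice_ level_) (arc_ choice_ (var IDX_J)))))))))).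

(** [r] records a vertex [j] for which no pair [p], [q] satisfies [cond], so [Not (var r)] has the
    quantifiers of [accepted]. *)
Definition Test r cond := Any r IDX_J order_
  (Any FOUND_P IDX_P order_ (Any FOUND_Q IDX_Q order_ Skip cond) (var FOUND_Q))
  (Not (var FOUND_P)).

Definition cyc3_ := And (arc_ (var IDX_J) (var IDX_P))
  (And (arc_ (var IDX_P) (var IDX_Q)) (arc_ (var IDX_Q) (var IDX_J))).

Definition maximal_ := Or (Or (Lt level_ (var IDX_J)) (inY_ (var IDX_J)))
  (And (And (inY_ (var IDX_P)) (inY_ (var IDX_Q))) cyc3_).

Definition kept_ x := And (inX_ x) (Or (inY_ x) (Lt x (var IDX_J))).

Definition child_ := Or (Or (Not (Lt (var IDX_J) level_)) (inX_ (var IDX_J)))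
  (And (And (kept_ (var IDX_P)) (kept_ (var IDX_Q))) cyc3_).

Definition accepted_ :=
  And (Or (Not (Lt choice_ level_))
          (And (inX_ choice_) (arc_ choice_ level_)))
      (And (Not (var NOT_MAXIMAL)) (Not (var NOT_CHILD))).

Definition NextChoice := Write CHOICE level_ (Plus choice_ (Const 1)).

(** The counter of the current level advances before [DEPTH] does; after the descent, [level_]
    denotes the child, whose counter is reset. *)
Definition Expand := Seq Build (Seq (Test NOT_MAXIMAL maximal_)
  (Seq (Test NOT_CHILD child_)
    (If accepted_
      (Seq NextChoice (Seq (Set_ DEPTH (Plus depth_ (Const 1)))
                           (Write CHOICE level_ (Const 0))))
      NextChoice))).

Definition Pop := Set_ DEPTH level_.

Definition PrintComplement :=
  For IDX_J order_ (If (inX_ (var IDX_J)) Skip (Print (var IDX_J))).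

(** Depth [n.+1] is a leaf. At level [k] the depth is [k.+1], so a counter above it means that all
    [k.+2] candidates have been tried. *)
Definition Body := If (Lt order_ depth_)
  (Seq PrintComplement (Seq Emit Pop))
  (If (Lt depth_ choice_) Pop Expand).

Definition Search_ := While depth_ Body.

(** The row offsets are tabulated by repeated addition, as the machine cannot multiply. *)
Definition Init := Seq (Set_ ROW (Const 1))
  (Seq (For IDX_J order_ (Write ROW (Plus (var IDX_J) (Const 1))
                         (Plus (Read ROW (var IDX_J)) order_)))
       (Set_ DEPTH (Const 1))).

Definition Enumerate := Seq Init Search_.

Lemma has_iota_ord n (phi : pred nat) :
  has phi (iota 0 n) = [exists x : 'I_n, phi x].
Proof.
rewrite -val_enum_ord has_map; apply/hasP/existsP => [[x _]|[x px]].
  by exists x.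
by exists x; rewrite ?mem_enum.
Qed.

(** Exceeds every counter and every matrix index [1 + k * n + x] with [k, x <= n]. *)
Definition bound n := n.+2 * n.+2.

(** * Building a candidate and testing it *)

Section Blocks.

Variables (n : nat) (arc : rel 'I_n).

Notation fits := (fits (bound n)).
Notation wp := (wp n (bound n)).

Lemma row_lt k x : k <= n -> x <= n -> 1 + k * n + x < bound n.
Proof. rewrite /bound; nia. Qed.

Lemma lt_bound k : k <= n.+2 -> k < bound n.
Proof. rewrite /bound; nia. Qed.

Lemma order_lt_bound : n < bound n.
Proof. by apply: lt_bound; rewrite -addn2 leq_addr. Qed.

Definition base m := (forall i, read m ADJ i = nth 0 (encode arc) i) /\
  (forall i, i <= n -> read m ROW i = 1 + i * n).

Definition row k (X : {set 'I_n}) m :=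
  forall x : 'I_n, (read m SET (1 + k * n + x) != 0) = (x \in X).

(** What a visit at level [k] leaves intact: the input, the row offsets, the sets of levels up to
    [k] and the counters of the levels above it in the tree. *)
Definition pres k m m' := [/\ forall a i, a < 2 -> read m' a i = read m a i,
  forall i, i < 1 + k.+1 * n -> read m' SET i = read m SET i
  & forall i, i < k -> read m' CHOICE i = read m CHOICE i].

Lemma pres_trans k m1 m2 m3 : pres k m1 m2 -> pres k m2 m3 -> pres k m1 m3.
Proof.
move=> [a1 s1 c1] [a2 s2 c2].
by split=> [a i ai|i ik|i ik]; [rewrite a2 ?a1|rewrite s2 ?s1|rewrite c2 ?c1].
Qed.

Lemma pres_le k k' m m' : k <= k' -> pres k' m m' -> pres k m m'.
Proof.
move=> kk' [ha hs hc]; split=> // i ik; last by apply: hc; apply: leq_trans kk'.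
by apply: hs; apply: leq_trans ik _; rewrite leq_add2l leq_mul2r ltnS kk' orbT.
Qed.

Lemma pres_base k m m' : pres k m m' -> base m -> base m'.
Proof.
by move=> [ha _ _] [b0 b1]; split=> [i|i ik]; rewrite ha ?b0 ?b1.
Qed.

Lemma pres_row k j X m m' : pres k m m' -> j <= k -> row j X m -> row j X m'.
Proof.
move=> [_ hs _] jk rX x; rewrite hs //.
have := ltn_ord x; nia.
Qed.

Lemma eval_order m : base m -> eval m order_ = n.
Proof. by case=> b0 _; rewrite /= b0. Qed.

Lemma eval_level m k : read m DEPTH 0 = k.+1 -> eval m level_ = k.
Proof. by move=> /= ->; rewrite subn1. Qed.

Lemma truthy_arc m e f : base m -> eval m e <= n ->
  truthy m (arc_ e f) = adj arc (eval m e) (eval m f).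
Proof. by move=> [b0 b1] en; rewrite /truthy /= b0 b1. Qed.

Lemma truthy_inX m k X e (x : 'I_n) : base m -> read m DEPTH 0 = k.+1 ->
  k <= n -> row k X m -> eval m e = x -> truthy m (inX_ e) = (x \in X).
Proof.
move=> [_ b1] dk kn rX ex; rewrite -rX /truthy /inX_ /= dk subn1 ex b1 //.
Qed.

Lemma truthy_inY m k Y e (x : 'I_n) : base m -> read m DEPTH 0 = k.+1 ->
  k < n -> row k.+1 Y m -> eval m e = x -> truthy m (inY_ e) = (x \in Y).
Proof. by move=> [_ b1] dk kn rY ex; rewrite -rY /truthy /inY_ /= dk ex b1. Qed.

Lemma wp_build m o k X c : fits m -> base m -> read m DEPTH 0 = k.+1 ->
  k < n -> row k X m -> read m CHOICE k = c -> c < k.+2 ->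
  wp Build m o (fun m' o' => [/\ o' = o, pres k m m', read m' DEPTH 0 = k.+1,
    read m' CHOICE k = c & row k.+1 (cand arc X k c) m']).
Proof.
move=> f bm dm kn rX cm ck.
pose I i m' o' := [/\ o' = o, frame [:: SET; IDX_J] m m',
  forall j, j < 1 + k.+1 * n -> read m' SET j = read m SET j, read m' IDX_J 0 = i
  & forall x : 'I_n, x < i ->
    (read m' SET (1 + k.+1 * n + x) != 0) = (x \in cand arc X k c)].
have Ipres i m' o' : I i m' o' -> [/\ pres k m m', read m' DEPTH 0 = k.+1
    & read m' CHOICE k = c].
  move=> [_ fr sm _ _]; split; [split|by rewrite fr|by rewrite fr].
  - by move=> [|[|a]] j // _; rewrite fr.
  - exact: sm.
  - by move=> j _; rewrite fr.
apply: (wp_conseq (Q := I n)); last first.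
  move=> m' o' _ Im'; have [p d ch] := Ipres _ _ _ Im'.
  case: Im' => -> _ _ _ rY; split=> // x; exact: rY.
apply: wp_for => //; first exact: order_lt_bound.
- split=> // [a|j _|]; rewrite ?inE ?negb_or; try by rewrite read_write.
  by case/andP=> _ aJ i; rewrite read_write (negPf aJ).
- move=> i m' o' _ Im'; have [p _ _] := Ipres _ _ _ Im'; have b' := pres_base p bm.
  by case: Im' => _ _ _ -> _; split=> //; apply: eval_order.
move=> i m' o' iN f' Im'; have [p d' c'] := Ipres _ _ _ Im'.
have b' := pres_base p bm; have rX' := pres_row p (leqnn k) rX.
case: Im' => -> fr sm rJ rY.
have eJ : eval m' (var IDX_J) = i by [].
have eD : eval m' depth_ = k.+1 by [].
have eL := eval_level d'.
have eC : eval m' choice_ = c by rewrite /choice_ -c' -[in RHS]eL.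
have idx : eval m' (Plus (Read ROW depth_) (var IDX_J)) = 1 + k.+1 * n + i.
  by rewrite /= d' rJ; case: b' => _ ->.
have val_x : truthy m' (Or (And (Eq (var IDX_J) level_) (Not (Lt level_ choice_)))
    (And (inX_ (var IDX_J)) (Or (Eq choice_ depth_)
      (Iff (arc_ level_ (var IDX_J))
           (Or (Eq choice_ level_) (arc_ choice_ (var IDX_J))))))) =
    (Ordinal iN \in cand arc X k c).
  rewrite !truthyE !truthy_arc ?eL ?eC ?eD ?eJ ?(ltnW kn) //; last first.
    by rewrite -ltnS (leq_trans ck).
  by rewrite (truthy_inX (x := Ordinal iN) b' d' (ltnW kn) rX') // inE -leqNgt.
apply: wp_write => //; rewrite ?idx.
- by apply: row_lt => //; apply: ltnW.
- by rewrite eval_Not; case: (~~ _) => //; apply: lt_bound.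
rewrite eval_Not truthyNot negbK val_x.
split; first by rewrite read_write.
split=> //.
- move=> a; rewrite !inE negb_or => /andP[aS aJ] j; rewrite !read_write.
  by rewrite (negPf aS) (negPf aJ) fr // !inE negb_or aS.
- by move=> j jk; rewrite !read_write /= ltn_eqF ?sm // (leq_trans jk) ?leq_addr.
- by rewrite read_write.
move=> x; rewrite ltnS leq_eqVlt !read_write /= eqn_add2l => /predU1P[xi|xi].
  have -> : x = Ordinal iN by apply: val_inj.
  by rewrite /= eqxx eqb0 negbK.
by rewrite (ltn_eqF xi) rY.
Qed.

Lemma frame_sub (W W' : seq nat) m m' : {subset W <= W'} -> frame W m m' ->
  frame W' m m'.
Proof. by move=> sW fr a aW i; apply: fr; apply: contra aW; apply: sW. Qed.

Lemma frame_trans W m1 m2 m3 : frame W m1 m2 -> frame W m2 m3 -> frame W m1 m3.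
Proof. by move=> f1 f2 a aW i; rewrite f2 ?f1. Qed.

Lemma frame_base W m m' : 0 \notin W -> 1 \notin W -> frame W m m' ->
  base m -> base m'.
Proof. by move=> W0 W1 fr [b0 b1]; split=> *; rewrite fr ?b0 ?b1. Qed.

Lemma wp_any_ord r v c b (phi : pred 'I_n) W m o :
  fits m -> base m -> r < arrays -> v < arrays ->
  uniq [:: r, v & W] -> 0 \notin [:: r, v & W] -> 1 \notin [:: r, v & W] ->
  (forall (x : 'I_n) m', fits m' -> frame (r :: v :: W) m m' ->
    read m' v 0 = x -> wp c m' o (fun m'' o' =>
      [/\ o' = o, frame W m' m'' & truthy m'' b = phi x])) ->
  wp (Any r v order_ c b) m o (fun m' o' => [/\ o' = o, frame (r :: v :: W) m m'
    & truthy m' (var r) = [exists x, phi x]]).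
Proof.
move=> f bm ra va; rewrite [uniq _]/= inE negb_or.
case/and3P=> /andP[rv rW] vW _ W0 W1 step_c.
pose phi' i := if insub i is Some x then phi x else false.
have -> : [exists x, phi x] = has phi' (iota 0 n).
  by rewrite has_iota_ord; apply: eq_existsb => x; rewrite /phi' valK.
apply: wp_any => //; first exact: order_lt_bound.
  by move=> m' fr; apply: eval_order; apply: frame_base fr bm.
move=> i m' iN f' fr' vi; have := step_c (Ordinal iN) m' f' fr' vi.
by rewrite /phi' insubT.
Qed.

Lemma wp_test r cond m o (D : pred 'I_n) (S : 'I_n -> {set 'I_n}) :
  r \in [:: NOT_MAXIMAL; NOT_CHILD] -> fits m -> base m ->
  (forall m' (j p q : 'I_n), frame [:: r; IDX_J; FOUND_P; IDX_P; FOUND_Q; IDX_Q] m m' ->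
    read m' IDX_J 0 = j -> read m' IDX_P 0 = p -> read m' IDX_Q 0 = q ->
    truthy m' cond = D j || [&& p \in S j, q \in S j & cyc3 arc j p q]) ->
  wp (Test r cond) m o (fun m' o' => [/\ o' = o,
    frame [:: r; IDX_J; FOUND_P; IDX_P; FOUND_Q; IDX_Q] m m'
    & truthy m' (Not (var r)) = [forall j, D j || blocked arc (S j) j]]).
Proof.
move=> rE f bm condE; pose psi j p q :=
  D j || [&& p \in S j, q \in S j & cyc3 arc j p q].
apply: (wp_conseq (Q := fun m' o' => [/\ o' = o,
    frame [:: r; IDX_J; FOUND_P; IDX_P; FOUND_Q; IDX_Q] m m'
    & truthy m' (var r) = [exists j, ~~ [exists p, exists q, psi j p q]]])).
  apply: wp_any_ord => //; try by move: rE; rewrite !inE => /orP[]/eqP->.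
  move=> j m1 f1 fr1 j1.
  have b1 : base m1.
    by apply: frame_base fr1 bm; move: rE; rewrite !inE => /orP[]/eqP->.
  apply: (wp_conseq (Q := fun m' o' => [/\ o' = o,
      frame [:: FOUND_P; IDX_P; FOUND_Q; IDX_Q] m1 m'
      & truthy m' (var FOUND_P) = [exists p, exists q, psi j p q]])); last first.
    by move=> m' o' _ [-> fr E]; rewrite truthyNot E.
  apply: wp_any_ord => // p m2 f2 fr2 p2.
  apply: wp_any_ord => // [|q m3 f3 fr3 q3]; first exact: frame_base fr2 b1.
  apply: wp_skip => //; split=> //; apply: condE; rewrite ?q3 //.
  - apply: frame_trans fr1 _.
    apply: (@frame_sub [:: FOUND_P; IDX_P; FOUND_Q; IDX_Q]).
      by move=> a; rewrite !inE => /or4P[]/eqP->; rewrite eqxx ?orbT.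
    apply: frame_trans fr2 _; apply: frame_sub fr3.
    by move=> a; rewrite !inE => /orP[]/eqP->.
  - by rewrite fr3 // fr2.
  - by rewrite fr3.
move=> m' o' _ [-> fr E]; split=> //; rewrite truthyNot E negb_exists.
apply: eq_forallb => j; rewrite negbK /psi.
apply/existsP/orP => [[p /existsP[q /orP[->|c]]]|[Dj|/blockedP[p [q [pS qS c]]]]].
- by left.
- by right; apply/blockedP; exists p, q; case/and3P: c.
(* [D j] does not depend on [p] and [q]; the vertex [j] itself serves for both. *)
- by exists j; apply/existsP; exists j; rewrite Dj.
by exists p; apply/existsP; exists q; rewrite pS qS c orbT.
Qed.

End Blocks.

(** * Rounds of the search, printing, and initialisation *)

Section Rounds.

Variables (n : nat) (arc : rel 'I_n).

Notation fits := (fits (bound n)).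
Notation wp := (wp n (bound n)).
Notation pres := (pres n).
Notation base := (base arc).

Lemma frame_pres W k m m' : all (leq IDX_J) W -> frame W m m' -> pres k m m'.
Proof.
move=> /allP W5 fr; have low a : a < IDX_J -> a \notin W.
  by move=> a5; apply/negP => /W5; rewrite leqNgt a5.
by split=> [a i a2|i _|i _]; rewrite fr // low // (leq_trans a2).
Qed.

Lemma truthy_cyc3 m (j p q : 'I_n) : base m -> read m IDX_J 0 = j ->
  read m IDX_P 0 = p -> read m IDX_Q 0 = q -> truthy m cyc3_ = cyc3 arc j p q.
Proof.
move=> bm mj mp mq; rewrite truthyAnd truthyAnd.
have arcE e f (x y : 'I_n) : eval m e = x -> eval m f = y ->
    truthy m (arc_ e f) = arc x y.
  by move=> ex fy; rewrite (@truthy_arc n arc) ?ex ?fy ?adj_arc //; apply: ltnW.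
by rewrite (arcE _ _ j p) // (arcE _ _ p q) // (arcE _ _ q j).
Qed.

Lemma wp_expand m o k X c : fits m -> base m -> read m DEPTH 0 = k.+1 ->
  k < n -> row k X m -> read m CHOICE k = c -> c < k.+2 ->
  wp Expand m o (fun m' o' => [/\ o' = o, pres k m m', read m' CHOICE k = c.+1
    & if accepted arc X k c
      then [/\ read m' DEPTH 0 = k.+2, row k.+1 (cand arc X k c) m'
              & read m' CHOICE k.+1 = 0]
      else read m' DEPTH 0 = k.+1]).
Proof.
move=> f bm dm kn rX cm ck; set Y := cand arc X k c.
apply: wp_seq => //; apply: wp_conseq (wp_build o f bm dm kn rX cm ck) _.
move=> m1 o1 f1 [-> p1 d1 c1 rY] _.
have b1 := pres_base p1 bm; have rX1 := pres_row p1 (leqnn k) rX.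
apply: wp_seq => //.
pose D1 (j : 'I_n) := (k < j) || (j \in Y).
apply: (wp_conseq (wp_test (r := NOT_MAXIMAL) (D := D1) (S := fun=> Y) o _ f1 b1 _)).
- by [].
- move=> m' j p q fr mj mp mq.
  (* Level [k.+1], not [k]: the candidate just built must survive the tests. *)
  have pr : pres k.+1 m1 m' by apply: frame_pres fr.
  have b' := pres_base pr b1; have rY' := pres_row pr (leqnn _) rY.
  have d' : read m' DEPTH 0 = k.+1 by rewrite fr.
  rewrite truthyOr truthyOr truthyLt (eval_level d') [eval _ _]mj.
  rewrite truthyAnd (truthy_cyc3 b' mj mp mq) truthyAnd -andbA.
  have inY e (x : 'I_n) : eval m' e = x -> truthy m' (inY_ e) = (x \in Y).
    exact: truthy_inY b' d' kn rY'.
  by rewrite (inY _ j) // (inY _ p) // (inY _ q).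
move=> m2 o2 f2 [-> fr2 t2] _.
have pr2 : pres k.+1 m1 m2 by apply: frame_pres fr2.
have b2 := pres_base pr2 b1; have rY2 := pres_row pr2 (leqnn _) rY.
have rX2 := pres_row pr2 (leqnSn _) rX1.
have d2 : read m2 DEPTH 0 = k.+1 by rewrite fr2.
apply: wp_seq => //.
pose D2 (j : 'I_n) := (k <= j) || (j \in X).
pose S2 (j : 'I_n) := [set x in X | (x \in Y) || (x < j)].
apply: (wp_conseq (wp_test (r := NOT_CHILD) (D := D2) (S := S2) o _ f2 b2 _)).
- by [].
- move=> m' j p q fr mj mp mq.
  have pr : pres k.+1 m2 m' by apply: frame_pres fr.
  have b' := pres_base pr b2; have rY' := pres_row pr (leqnn _) rY2.
  have rX' := pres_row pr (leqnSn _) rX2.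
  have d' : read m' DEPTH 0 = k.+1 by rewrite fr.
  have kept (x : 'I_n) e : eval m' e = x -> truthy m' (kept_ e) = (x \in S2 j).
    move=> ex; rewrite truthyAnd truthyOr truthyLt ex.
    rewrite (truthy_inX b' d' (ltnW kn) rX' ex) (truthy_inY b' d' kn rY' ex).
    by rewrite [in RHS]in_set [eval m' _]mj.
  rewrite truthyOr truthyOr truthyNot truthyLt (eval_level d') -leqNgt.
  rewrite truthyAnd (truthy_cyc3 b' mj mp mq) truthyAnd (kept p) // (kept q) //.
  by rewrite (truthy_inX (x := j) b' d' (ltnW kn) rX') // [eval _ _]mj -andbA.
move=> m3 o3 f3 [-> fr3 t3] _.
have pr3 : pres k.+1 m2 m3 by apply: frame_pres fr3.
have b3 := pres_base pr3 b2; have rY3 := pres_row pr3 (leqnn _) rY2.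
have rX3 := pres_row pr3 (leqnSn _) rX2.
have d3 : read m3 DEPTH 0 = k.+1 by rewrite fr3.
have c3 : read m3 CHOICE k = c by rewrite fr3 // fr2.
have eL := eval_level d3.
have eC : eval m3 choice_ = c by rewrite /choice_ -c3 -[in RHS]eL.
have p3 : pres k m m3.
  by apply: pres_trans p1 _; apply: (@pres_le n k k.+1) => //; apply: pres_trans pr3.
have acc : truthy m3 accepted_ = accepted arc X k c.
  rewrite /accepted_ truthyAnd truthyOr truthyNot truthyLt eC eL truthyAnd.
  rewrite truthyAnd [truthy m3 (Not (var NOT_CHILD))]t3.
  have -> : truthy m3 (Not (var NOT_MAXIMAL)) = truthy m2 (Not (var NOT_MAXIMAL)).
    by rewrite !truthyNot /truthy /= fr3.
  rewrite t2 /accepted -/Y; congr (_ && (_ && _)).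
  (* The pivot condition matters only for [c < k], and then [c] is a vertex. *)
  have [clk|] //= := ltnP c k.
  rewrite (@truthy_arc n arc) ?eC ?eL // ?(ltnW (ltn_trans clk kn)) //.
  have cn := ltn_trans clk kn.
  rewrite (truthy_inX (x := Ordinal cn) b3 d3 (ltnW kn) rX3 eC).
  by rewrite -natmemE.
apply: wp_if => //; rewrite acc.
have wpN K : (fits (write m3 CHOICE k c.+1) -> K (write m3 CHOICE k c.+1) o) ->
    wp NextChoice m3 o K.
  move=> HK; have fw : fits (write m3 CHOICE k c.+1).
    by apply: fits_write => //; apply: (lt_bound) => //; try apply/ltnW; lia.
  apply: wp_write; rewrite ?eL //=.
  - by apply: lt_bound; lia.
  - by rewrite /= d3 subn1 c3 addn1; apply/ltnW/lt_bound; lia.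
  by rewrite /= d3 subn1 /= c3 addn1; apply: HK.
have pw m' k' v : k <= k' -> pres k m m' -> pres k m (write m' CHOICE k' v).
  move=> kk' pm; apply: pres_trans pm _.
  split=> [[|[|a]] i //|i _|i ik]; rewrite read_write //=.
  by rewrite ltn_eqF // (leq_trans ik).
case: ifP => _; last first.
  apply: wpN => fw; split=> //; first exact: pw.
    by rewrite read_write !eqxx.
  by rewrite read_write.
apply: wp_seq => //; apply: wpN => fw _; set m4 := write _ _ _ _ in fw *.
have d4 : read m4 DEPTH 0 = k.+1 by rewrite read_write.
apply: wp_seq => //; apply: wp_write => //=.
- by rewrite d4; apply/ltnW/lt_bound; lia.
rewrite d4 addn1 => f5; set m5 := write m4 _ _ _ in f5 *.
have d5 : read m5 DEPTH 0 = k.+2 by rewrite read_write.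
apply: wp_write => //=.
- by rewrite d5; apply: lt_bound; lia.
rewrite d5 subn1 /=; split=> //.
- apply: (pw _ k.+1) => //; apply: pres_trans (pw _ _ _ (leqnn k) p3) _.
  by split=> [[|[|a]] i //|i _|i ik]; rewrite /m5 read_write /=.
- by rewrite !read_write /= ltn_eqF // eqxx.
split; first by rewrite !read_write.
- by move=> x; rewrite !read_write /=; apply: rY3.
by rewrite !read_write !eqxx.
Qed.

Lemma wp_print_complement m (X : {set 'I_n}) : fits m -> base m ->
  read m DEPTH 0 = n.+1 -> row n X m ->
  wp PrintComplement m [::] (fun m' o' =>
    frame [:: IDX_J] m m' /\ represents o' (~: X)).
Proof.
move=> f bm dm rX.
pose out i := [seq x <- iota 0 i | read m SET (1 + n * n + x) == 0].
pose I i m' o' := [/\ o' = out i, frame [:: IDX_J] m m' & read m' IDX_J 0 = i].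
apply: (wp_conseq (Q := I n)); last first.
  move=> m' o' _ [-> fr _]; split=> //; apply: uniq_perm.
  - by rewrite filter_uniq ?iota_uniq.
  - by rewrite map_inj_uniq ?enum_uniq //; apply: val_inj.
  move=> x; rewrite mem_filter mem_iota /= add0n.
  apply/andP/mapP => [[rx xn]|[y]].
    by exists (Ordinal xn) => //; rewrite mem_enum inE -rX /= rx.
  by rewrite mem_enum inE -rX negbK => ry ->.
apply: wp_for => //; first exact: order_lt_bound.
- split=> // [a|]; last by rewrite read_write.
  by rewrite inE => aJ i; rewrite read_write (negPf aJ).
- move=> i m' o' _ [_ fr ->]; split=> //.
  by apply: (@eval_order n arc); apply: frame_base fr bm.
move=> i m' o' iN f' [-> fr rJ].
have eX : truthy m' (inX_ (var IDX_J)) = (read m SET (1 + n * n + i) != 0).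
  by rewrite /truthy /= rJ !fr // dm subn1 /=; case: bm => _ ->.
have outS : out i.+1 = if truthy m' (inX_ (var IDX_J)) then out i else rcons (out i) i.
  rewrite eX /out -(addn1 i) iotaD filter_cat /= add0n.
  by case: eqP; rewrite ?cats1 ?cats0.
have fr' : frame [:: IDX_J] m (write m' IDX_J 0 i.+1).
  by move=> a; rewrite inE => aJ j; rewrite read_write (negPf aJ) fr // inE.
apply: wp_if => //; case: ifP outS => _ outS.
  by apply: wp_skip => //; split=> //; split; rewrite ?read_write ?outS.
by apply: wp_print => //; split=> //; split; rewrite ?read_write ?outS //= rJ.
Qed.

Lemma fits_input : fits [:: encode arc].
Proof.
have size_enc : size (encode arc) = (n * n).+1.
  by rewrite /= size_allpairs size_enum_ord.
split=> // [[|a]|[|a] i]; rewrite ?nth_nil //.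
- by rewrite [nth _ _ _]/= size_enc /bound; nia.
- by rewrite /= nth_nil.
- rewrite /read [nth [::] _ _]/=; have [lt|ge] := ltnP i (size (encode arc)); last first.
    by rewrite nth_default.
  have : nth 0 (encode arc) i \in encode arc by apply: mem_nth.
  rewrite inE => /predU1P[->|/allpairsP[[x y] [_ _ ->]]].
    exact/ltnW/order_lt_bound.
  by case: (arc _ _) => //=; rewrite /bound; nia.
by rewrite /read /= nth_nil nth_nil.
Qed.

Lemma wp_init : wp Init [:: encode arc] [::] (fun m' o' => [/\ o' = [::], base m',
  read m' DEPTH 0 = 1, row 0 (set0 : {set 'I_n}) m' & read m' CHOICE 0 = 0]).
Proof.
pose I i m' o' := [/\ o' = [::] :> seq nat, frame [:: ROW; IDX_J] [:: encode arc] m',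
  read m' IDX_J 0 = i & forall x, x <= i -> read m' ROW x = 1 + x * n].
have f0 := fits_input.
apply: wp_seq => //; apply: wp_write => //=.
move=> f1; set m1 := write _ _ _ _ in f1 *.
apply: wp_seq => //; apply: (wp_conseq (Q := I n)).
  apply: wp_for => //; first exact: order_lt_bound.
  - split=> // [a|x]; first rewrite !inE negb_or => /andP[a1 a5] i.
      by rewrite !read_write (negPf a1) (negPf a5).
    by rewrite leqn0 => /eqP->; rewrite !read_write.
  - move=> i m' o' _ [_ fr -> _]; split=> //.
    by rewrite [eval _ _]fr.
  move=> i m' o' iN f' [-> fr rJ rR].
  have ord : read m' ADJ 0 = n by rewrite fr.
  have val_row : 1 + i * n + n = 1 + i.+1 * n by rewrite mulSnr addnA.
  apply: wp_write => //=; rewrite ?rJ ?ord ?rR // ?val_row ?addn1.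
  - by apply: lt_bound; lia.
  - by have := @row_lt n n 0 (leqnn n) isT; rewrite addn0; move: iN; nia.
  split; first by rewrite read_write.
  split=> //.
  - move=> a; rewrite !inE negb_or => /andP[a1 a5] j.
    by rewrite !read_write (negPf a1) (negPf a5) fr // !inE negb_or a1.
  - by rewrite read_write.
  move=> x; rewrite leq_eqVlt !read_write /= => /predU1P[->|xi].
    by rewrite eqxx.
  by rewrite ltn_eqF // rR.
move=> m2 o2 f2 [-> fr rJ rR] _; apply: wp_write => //=.
split=> //.
- by split=> [i|i ik]; rewrite read_write /= ?rR ?fr //.
- by rewrite read_write.
- by move=> x; rewrite read_write fr // inE /read nth_default /= ?nth_nil.
by rewrite read_write /= fr.
Qed.

End Rounds.

(** * Depth-first search *)

Section Runs.

Variables (prog : cmd) (input : seq nat) (M B D : nat).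

Definition within t t' := t <= t' <= t + D.

(* [os] is the output up to time [t]; the last output, or the start, lies at
   most [lag] steps back. *)
Definition reached t s os lag := let last_output := last 0 (unzip1 os) in
  [/\ run prog input t = s, forall i, i <= t -> fits B (store (run prog input i)),
      outputs prog input t = os, path within 0 (unzip1 os)
    & last_output <= t <= last_output + lag].

Lemma reached_le t s os l l' : l <= l' -> reached t s os l -> reached t s os l'.
Proof.
move=> ll' [? ? ? ? /andP[lt tl]]; split=> //.
by rewrite lt (leq_trans tl) ?leq_add2l.
Qed.

Lemma runD t u : run prog input (t + u) = iter u step (run prog input t).
Proof. by rewrite /run addnC iterD. Qed.

Lemma reached_silent t s os l u s' : reached t s os l -> silent B u s s' ->
  reached (t + u) s' os (l + u).
Proof.
move=> [rt ft ot pt /andP[lt tl]] [is_ ns fs]; split=> //.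
- by rewrite runD rt.
- move=> i it; have [le|lt_ti] := leqP i t; first exact: ft.
  by rewrite -(subnKC (ltnW lt_ti)) runD rt; apply: fs; rewrite leq_subLR.
- rewrite /outputs iotaD pmap_cat -/(outputs prog input t) ot add0n.
  set r := pmap _ _; suff -> : r = [::] by rewrite cats0.
  apply/eqP; rewrite -size_eq0 size_pmap -leqn0 leqNgt -has_count; apply/hasPn.
  move=> i; rewrite mem_iota => /andP[ti itu] /=.
  by rewrite -(subnKC ti) runD rt ns ?ltn_subLR.
by rewrite (leq_trans lt) ?leq_addr // addnA leq_add2r.
Qed.

(** The solution counts as complete one step after [Emit] is reached, hence the strict bound on [l];
    the lag then restarts at 0. *)
Lemma reached_emit t K m o os l : reached t (Config (Emit :: K) m o) os l ->
  l < D -> reached t.+1 (Config K m [::]) (rcons os (t.+1, o)) 0.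
Proof.
move=> [rt ft ot pt /andP[lt tl]] lD.
have os1 : unzip1 (rcons os (t.+1, o)) = rcons (unzip1 os) t.+1 by exact: map_rcons.
rewrite /reached os1 last_rcons rcons_path pt addn0 leqnn; split=> //.
- by rewrite -addn1 runD rt.
- move=> i; rewrite leq_eqVlt => /predU1P[->|]; last exact: ft.
  by rewrite -addn1 runD rt; have := ft t (leqnn t); rewrite rt.
- rewrite /outputs -addn1 iotaD pmap_cat -/(outputs prog input t) ot add0n /=.
  by rewrite rt -cats1 addn1.
by rewrite /within (leqW lt) /= (leq_ltn_trans tl) // ltn_add2l.
Qed.

Lemma reached_wp t c K m o os l Q :
  reached t (Config (c :: K) m o) os l -> wp M B c m o Q ->
  exists t' m' o', reached t' (Config K m' o') os (l + cost M c) /\ Q m' o'.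
Proof.
move=> rt [u [m' [o' [uc q _ s]]]]; exists (t + u), m', o'; split=> //.
by apply: reached_le (reached_silent rt (s K)); rewrite leq_add2l.
Qed.

Lemma reached_fits t s os l : reached t s os l -> fits B (store s).
Proof. by move=> [<- ft _ _ _]; apply: ft. Qed.

Lemma reached_step t s s' os l : reached t s os l -> step s = s' ->
  store s = store s' -> emitted s = None -> reached t.+1 s' os l.+1.
Proof.
move=> rt es ss ns; have f := reached_fits rt.
rewrite -addn1 -(addn1 l); apply: reached_silent rt _.
by apply: silent1; rewrite -?ss.
Qed.

End Runs.

(** * The delay along the search tree *)

Definition round_cost M := 2 + cost M Body + cost M Init.
(** A node at level [k <= n] takes at most [k + 2] rounds for its candidates and one to close. *)
Definition node_cost n := (n + 3) * round_cost n.
(** Between two reports at most [n + 1] nodes are closed and [n] descended through; one more unit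
    pays for the leaf. *)
Definition delay n := (n + n + 2) * node_cost n.

Section DepthFirst.

Variables (n : nat) (arc : rel 'I_n).
Hypothesis arcT : tournament arc.

Notation fits := (fits (bound n)).
Notation wp := (wp n (bound n)).
Notation pres := (pres n).
Notation base := (base arc).
Notation reached := (reached Enumerate (encode arc) (bound n) (delay n)).
Notation T := (round_cost n).
Notation W := (node_cost n).

(* Every node reports a leaf.  Leaving level [k] after the last report, the
   search has only closed nodes at levels [>= k] since; on entering level [k],
   it may in addition have descended through [k] nodes. *)
Definition lag_exit k := (n - k).+1 * W.
Definition lag_enter k := lag_exit 0 + k * W.

Definition at_loop m := Config [:: Search_] m [::].

Definition reports (os : seq (nat * seq nat)) (Ls : seq {set 'I_n}) :=
  all2 (@represents n) (unzip2 os) [seq ~: L | L <- Ls].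

Lemma reports_cat os1 os2 Ls1 Ls2 : reports os1 Ls1 -> reports os2 Ls2 ->
  reports (os1 ++ os2) (Ls1 ++ Ls2).
Proof.
rewrite /reports; elim: os1 Ls1 => [|x os1 IH] [|L Ls1] //= /andP[-> r1] r2.
exact: IH.
Qed.

Lemma reports_nonempty os Ls : reports os Ls -> Ls != [::] -> os != [::].
Proof. by case: os; case: Ls. Qed.

Lemma round_le_node : T <= W.
Proof. by rewrite /node_cost leq_pmull // addn3. Qed.

Lemma reached_round t m os l Q : reached t (at_loop m) os l ->
  read m DEPTH 0 != 0 -> wp Body m [::] (fun m' o' => o' = [::] /\ Q m') ->
  exists t' m', reached t' (at_loop m') os (l + T) /\ Q m'.
Proof.
move=> rt d0 wpB.
have r1 : reached t.+1 (Config [:: Body; Search_] m [::]) os l.+1.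
  by apply: reached_step rt _ _ _ => //=; rewrite d0.
have [t' [m' [o' [r2 [o0 q]]]]] := reached_wp r1 wpB.
exists t', m'; split=> //; rewrite /at_loop -o0; apply: reached_le r2.
by rewrite /round_cost; lia.
Qed.

(** The round contains an [Emit], so it is followed step by step, with triples only for the silent
    stretches. *)
Lemma reached_leaf t m os l (X : {set 'I_n}) : reached t (at_loop m) os l ->
  base m -> read m DEPTH 0 = n.+1 -> row n X m -> l + T <= delay n ->
  exists t' m' os', [/\ reached t' (at_loop m') (os ++ os') T,
    pres n m m', read m' DEPTH 0 = n & reports os' [:: X]].
Proof.
move=> rt bm dm rX lD; have f := reached_fits rt.
have tl : truthy m (Lt order_ depth_) by rewrite truthyLt (eval_order bm) /= dm.
have r1 : reached t.+1 (Config [:: Body; Search_] m [::]) os l.+1.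
  by apply: reached_step rt _ _ _ => //=; rewrite dm.
have r2 : reached t.+2
    (Config [:: Seq PrintComplement (Seq Emit Pop); Search_] m [::]) os l.+2.
  by apply: reached_step r1 _ _ _ => //; move: tl; rewrite /truthy /= => ->.
have r3 : reached t.+3
    (Config [:: PrintComplement; Seq Emit Pop; Search_] m [::]) os l.+3.
  exact: reached_step r2 _ _ _.
have [t4 [m4 [o [r4 [fr rep]]]]] := reached_wp r3 (wp_print_complement f bm dm rX).
have r5 := reached_step r4 (erefl _) (erefl _) (erefl _).
have r6 := reached_emit r5 (_ : (l.+3 + cost n PrintComplement).+1 < delay n).
have {}r6 : reached t4.+2 (Config [:: Pop; Search_] m4 [::])
    (rcons os (t4.+2, o)) 0.
  by apply: r6; move: lD; rewrite /round_cost /=; lia.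
have f4 : fits m4 by have := reached_fits r4.
have d4 : read m4 DEPTH 0 = n.+1 by rewrite fr.
have wpPop : wp Pop m4 [::] (fun m' o' =>
    o' = [::] /\ (pres n m m' /\ read m' DEPTH 0 = n)).
  apply: wp_write => //=; first by rewrite d4 subn1; apply/ltnW/order_lt_bound.
  split=> //; rewrite d4 subn1 /= read_write; split=> //.
  by split=> [[|[|a]] i //|i _|i _]; rewrite read_write /= fr.
have [t7 [m7 [o7 [r7 [o0 [p7 d7]]]]]] := reached_wp r6 wpPop.
exists t7, m7, [:: (t4.+2, o)]; rewrite cats1; split=> //.
  by rewrite /at_loop -o0; apply: reached_le r7; rewrite /round_cost /=; lia.
by rewrite /reports /= rep.
Qed.


Definition explores k X := forall t m os l,
  reached t (at_loop m) os l -> base m -> read m DEPTH 0 = k.+1 -> row k X m ->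
  read m CHOICE k = 0 -> l <= lag_enter k ->
  exists t' m' os', [/\ reached t' (at_loop m') (os ++ os') (lag_exit k),
    pres k m m', read m' DEPTH 0 = k & reports os' (leaves arc (n - k) k X)].

Lemma wp_internal m k c Q : fits m -> base m -> read m DEPTH 0 = k.+1 ->
  k < n -> read m CHOICE k = c ->
  wp (if k.+1 < c then Pop else Expand) m [::] Q -> wp Body m [::] Q.
Proof.
move=> f bm dm kn cm wpQ; apply: wp_if => //.
rewrite truthyLt (eval_order bm) /= dm ltnNge kn /=.
by apply: wp_if => //; rewrite truthyLt /= dm subn1 /= cm.
Qed.

Lemma reached_pop t m os l k c : reached t (at_loop m) os l -> base m ->
  read m DEPTH 0 = k.+1 -> k < n -> read m CHOICE k = c -> k.+1 < c ->
  exists t' m', [/\ reached t' (at_loop m') os (l + T), pres k m m'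
    & read m' DEPTH 0 = k].
Proof.
move=> rt bm dm kn cm kc; have f := reached_fits rt.
have wpPop : wp Body m [::] (fun m' o' =>
    o' = [::] /\ (pres k m m' /\ read m' DEPTH 0 = k)).
  apply: (wp_internal f bm dm kn cm); rewrite kc.
  apply: wp_write => //=; rewrite dm subn1 /=.
    by apply: leq_trans (ltnW kn) _; apply/ltnW/order_lt_bound.
  rewrite read_write; split=> //; split=> //.
  by split=> [[|[|a]] i //|i _|i _]; rewrite read_write.
have d0 : read m DEPTH 0 != 0 by rewrite dm.
by have [t' [m' [r' [p' d']]]] := reached_round rt d0 wpPop; exists t', m'.
Qed.

(** Induction on the number [r] of candidates left. Until a leaf is reported, the lag grows from [l]
    by one round per candidate; afterwards it counts from the return of the last accepted child. *)
Lemma explores_choices k X : k < n -> maximal_below arc k X ->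
  (forall Y, maximal_below arc k.+1 Y -> explores k.+1 Y) ->
  forall r c t m os l, c + r = k.+2 ->
  reached t (at_loop m) os l -> base m -> read m DEPTH 0 = k.+1 -> row k X m ->
  read m CHOICE k = c -> l <= lag_enter k + c * T ->
  exists t' m' os', [/\ reached t' (at_loop m') (os ++ os')
      ((if os' == [::] then l else lag_exit k.+1) + r.+1 * T),
    pres k m m', read m' DEPTH 0 = k
    & reports os' (flatten [seq leaves arc (n - k.+1) k.+1 (cand arc X k c)
                           | c <- iota c r & accepted arc X k c])].
Proof.
move=> kn mX IH; elim=> [|r IHr] c t m os l cr rt bm dm rX cm lE.
  have kc : k.+1 < c by rewrite -cr addn0.
  have [t' [m' [r' p' d']]] := reached_pop rt bm dm kn cm kc.
  by exists t', m', [::]; rewrite cats0 mul1n.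
have f := reached_fits rt; have ck : c < k.+2 by rewrite -cr addnS ltnS leq_addr.
have cr' : c.+1 + r = k.+2 by rewrite addSn -addnS.
have wpB := wp_expand [::] f bm dm kn rX cm ck.
have {}wpB : wp Body m [::] (fun m' o' => o' = [::] /\
    [/\ pres k m m', read m' CHOICE k = c.+1
      & if accepted arc X k c
        then [/\ read m' DEPTH 0 = k.+2, row k.+1 (cand arc X k c) m'
                & read m' CHOICE k.+1 = 0]
        else read m' DEPTH 0 = k.+1]).
  apply: (wp_internal f bm dm kn cm); rewrite ltnNge -ltnS ck /=.
  by apply: wp_conseq wpB _ => m' o' _ [-> ? ? ?].
have d0 : read m DEPTH 0 != 0 by rewrite dm.
have [t1 [m1 [r1 [p1 c1 acc1]]]] := reached_round rt d0 wpB.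
have b1 := pres_base p1 bm; have rX1 := pres_row p1 (leqnn k) rX.
rewrite /=; case: ifP acc1 => [acc [d1 rY1 c0]|_ d1]; last first.
  have [|t' [m' [os' [r' p' d' rep]]]] := IHr _ _ _ _ _ cr' r1 b1 d1 rX1 c1.
    by rewrite mulSnr addnA leq_add2r.
  exists t', m', os'; split=> //; last exact: pres_trans p1 p'.
  by apply: reached_le r'; case: ifP => _; rewrite mulSn; lia.
have mY := cand_maximal arcT kn ck mX acc.
have lE' : l + T <= lag_enter k.+1.
  rewrite /lag_enter mulSnr addnA.
  (* The rounds spent here before descending are covered by the cost of one node. *)
  have : c.+1 * T <= W by rewrite /node_cost leq_mul2r; apply/orP; right; lia.
  by move: lE; rewrite /lag_enter mulSn; lia.
have [t2 [m2 [os2 [r2 p2 d2 rep2]]]] := IH _ mY _ _ _ _ r1 b1 d1 rY1 c0 lE'.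
have p2' : pres k m1 m2 by apply: (@pres_le n k k.+1).
have b2 := pres_base p2 b1; have rX2 := pres_row p2' (leqnn k) rX1.
have c2 : read m2 CHOICE k = c.+1 by case: p2 => _ _ ->.
have os2_ne : os2 != [::].
  by apply: reports_nonempty rep2 _; apply: leaves_nonempty => //; rewrite subnK.
(* The child reported a leaf, so the lag on return fits the budget for the next candidate. *)
have lE2 : lag_exit k.+1 <= lag_enter k + c.+1 * T.
  rewrite /lag_enter -addnA (leq_trans _ (leq_addr _ _)) //.
  by rewrite /lag_exit leq_mul2r ltnS subn0 leq_subr orbT.
have [t' [m' [os' [r' p' d' rep']]]] := IHr _ _ _ _ _ cr' r2 b2 d2 rX2 c2 lE2.
exists t', m', (os2 ++ os'); split=> //.
- rewrite catA; apply: reached_le r'.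
  have -> : (os2 ++ os' == [::]) = false by case: (os2) os2_ne.
  by rewrite mulSn; case: ifP => _; lia.
- by apply: pres_trans p1 _; apply: pres_trans p2' p'.
exact: reports_cat.
Qed.

Lemma explores_maximal f k X : f + k = n -> maximal_below arc k X ->
  explores k X.
Proof.
elim: f k X => [|f IHf] k X fk mX t m os l rt bm dm rX c0 lE.
  move: fk dm rX lE; rewrite add0n => -> {k mX c0} dm rX lE.
  have lD : l + T <= delay n.
    have := round_le_node; move: lE; rewrite /delay /lag_enter /lag_exit; nia.
  have [t' [m' [os' [r' p' d' rep]]]] := reached_leaf rt bm dm rX lD.
  exists t', m', os'; split=> //; last by rewrite subnn.
  by apply: reached_le r'; rewrite /lag_exit subnn mul1n round_le_node.
have kn : k < n by rewrite -fk addSn ltnS leq_addl.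
have IH Y : maximal_below arc k.+1 Y -> explores k.+1 Y.
  by apply: IHf; rewrite addnS -addSn.
have lE' : l <= lag_enter k + 0 * T by rewrite addn0.
have [t' [m' [os' [r' p' d' rep]]]] :=
  explores_choices kn mX IH (add0n _) rt bm dm rX c0 lE'.
exists t', m', os'; split=> //; last first.
  by rewrite -(subnSK kn).
have os'_ne : os' != [::].
  have := leaves_nonempty arcT (f := n - k) _ mX; rewrite subnK ?(ltnW kn) // => ne.
  by apply: reports_nonempty rep _; move: (ne erefl); rewrite -{1}(subnSK kn).
(* Since a leaf was reported, the remaining lag is that of leaving a child plus [k + 3] rounds, at
   most one more node. *)
apply: reached_le r'; rewrite (negPf os'_ne) /lag_exit -(subnSK kn).
rewrite [leqRHS]mulSnr leq_add2l.
by rewrite /node_cost leq_mul2r; apply/orP; right; lia.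
Qed.

End DepthFirst.

(** * Polynomial bounds and conclusion *)

Lemma poly_bounded_le f g :
  (forall n, f n <= g n) -> poly_bounded g -> poly_bounded f.
Proof. by move=> fg [p gp]; exists p => n; apply: leq_trans (gp n). Qed.

Lemma poly_bounded_delay : poly_bounded delay.
Proof.
have X := poly_boundedX; have C c := poly_boundedC c.
have cst c : poly_bounded (fun n => cost n c) by apply: poly_bounded_cost.
by do ?[apply: poly_boundedM | apply: poly_boundedD].
Qed.

Lemma poly_bounded_space :
  poly_bounded (fun n => arrays * (bound n * (bound n).+1)).
Proof.
have X := poly_boundedX; have C c := poly_boundedC c.
pose g n := arrays * (((n + 2) * (n + 2)) * ((n + 2) * (n + 2) + 1)).
apply: (@poly_bounded_le _ g).
  by move=> n; rewrite /g /bound addn1 addn2.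
by do ?[apply: poly_boundedM | apply: poly_boundedD].
Qed.

Lemma enumerate_run n (arc : rel 'I_n) : tournament arc ->
  exists t m os, reached Enumerate (encode arc) (bound n) (delay n) t
    (Config [::] m [::]) os (delay n) /\ reports os (leaves arc n 0 set0).
Proof.
move=> arcT; have TW := round_le_node n.
have r0 : reached Enumerate (encode arc) (bound n) (delay n) 0
    (Config [:: Enumerate] [:: encode arc] [::]) [::] 0.
  by split=> // i; rewrite leqn0 => /eqP->; apply: fits_input.
have r1 := reached_step r0 (erefl _) (erefl _) (erefl _).
have [t2 [m2 [o2 [r2 [o0 b2 d2 rX2 c2]]]]] := reached_wp r1 (wp_init arc).
rewrite o0 in r2.
have l2 : 1 + cost n Init <= lag_enter n 0.
  rewrite /lag_enter /lag_exit subn0 addn0 mulSn.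
  by move: TW; rewrite [round_cost n]/round_cost; lia.
have [t3 [m3 [os [r3 _ d3 rep]]]] := explores_maximal arcT (addn0 n)
  (maximal_below0 arc) r2 b2 d2 rX2 c2 l2.
rewrite subn0 in rep.
have r4 : reached Enumerate (encode arc) (bound n) (delay n) t3.+1
    (Config [::] m3 [::]) os (lag_exit n 0).+1.
  by apply: reached_step r3 _ _ _ => //=; rewrite d3.
exists t3.+1, m3, os; split=> //; apply: reached_le r4.
have : 0 < node_cost n by apply: leq_trans TW.
by rewrite /lag_exit /delay subn0; nia.
Qed.

Theorem theorem2 :
  exists (P : cmd) (delay_bound space_bound : {poly nat}),
    forall (n : nat) (arc : rel 'I_n), tournament arc ->
      enumerates_with_delay P (encode arc) (minimal_fvs arc) (delay_bound.[n])%R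
      /\ forall t : nat, space_used (run P (encode arc) t) <= (space_bound.[n])%R.
Proof.
have [p delay_p] := poly_bounded_delay; have [q space_q] := poly_bounded_space.
exists Enumerate, p, q => n arc arcT.
have [h [m [os [[rh fh oh ph /andP[lh hl]] rep]]]] := enumerate_run arcT.
split; last first.
  move=> t; apply: leq_trans (space_q n); apply: fits_space.
  (* After halting, the configuration no longer changes. *)
  have [th|ht] := leqP t h; first exact: fh.
  rewrite -(subnKC (ltnW ht)) runD rh.
  have -> : iter (t - h) step (Config [::] m [::]) = Config [::] m [::].
    by elim: (t - h) => //= i ->.
  by have := fh h (leqnn h); rewrite rh.
exists h, [seq ~: L | L <- leaves arc n 0 set0]; rewrite oh rh; split=> //.
- split.
    rewrite map_inj_uniq; last exact: setC_inj.
    by apply: leaves_uniq (maximal_below0 arc); rewrite ?addn0.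
  move=> F; rewrite -{1}[F]setCK mem_map; last exact: setC_inj.
  by have := mem_leaves arcT (~: F); rewrite setCK.
have sub x y : within (delay n) x y -> x <= y <= x + (p.[n])%R.
  by case/andP=> -> xy; apply: leq_trans xy _; rewrite leq_add2l.
apply: sub_path sub _ _ _; rewrite rcons_path ph /within lh.
exact: hl.
Qed.
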